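(* Let $N\in\mathbb Z\setminus\{0\}$ and $n\ge1$. The functional $tr$ satisfies $tr(cg_n)=tr(c)\,tr(g_n)$ for all $c\in Br_n(N)$ (where $cg_n\in Br_{n+1}(N)$).
   Context: $[N]=\frac{1-q^N}{1-q}$; all algebras are over $\mathbb Z[q,q^{-1},[N]^{-1}]$. $H_n$ is the Hecke algebra with generators $g_1,\dots,g_{n-1}$, the braid relations $g_ig_{i+1}g_i=g_{i+1}g_ig_{i+1}$, $g_ig_j=g_jg_i$ ($|i-j|>1$), and $g_i^2=(q-1)g_i+q$. The $q$-Brauer algebra $Br_n(N)$ has generators $g_1,\dots,g_{n-1}$ and $e$ (for $n\ge2$) and relations: the $g_i$ satisfy the relations of $H_n$; $e^2=[N]e$; $eg_i=g_ie$ for $i>2$; $eg_1=g_1e=qe$; $eg_2e=q^Ne$; $eg_2^{-1}e=q^{-1}e$; $g_2g_3g_1^{-1}g_2^{-1}e_{(2)}=e_{(2)}=e_{(2)}g_2g_3g_1^{-1}g_2^{-1}$ with $e_{(2)}=e(g_2g_3g_1^{-1}g_2^{-1})e$ (relations are imposed when all generators occurring exist). $Br_0(N)$ and $Br_1(N)$ are the ground ring. $Br_n(N)\subset Br_{n+1}(N)$ by sending generators to generators of the same name. Elements: $e_{(0)}=1$, $e_{(1)}=e$, $e_{(k+1)}=e(g_2\cdots g_{2k+1})(g_1^{-1}\cdots g_{2k}^{-1})e_{(k)}$; idempotents $\bar e=\frac1{[N]}e$, $\bar e_{(k)}=\frac1{[N]^k}e_{(k)}$. One has $Br_n(N)=\sum_k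 H_n\bar e_{(k)}H_n$. There is an algebra isomorphism $\Psi_k:\bar e_{(k)}Br_n(N)\bar e_{(k)}\to Br_{n-2k}(N)$ with $\Psi_k(\bar e_{(k)}g_i)=g_{i-2k}$ for $i>2k$ and $\Psi_k(\bar e_{(k+1)})=\bar e$. The functional $tr$ on $Br_n(N)$ ($n\ge0$) is the unique linear functional defined by induction on $n$ as follows: on $H_n$ it is the Markov trace, i.e. the trace functional with $tr(1)=1$ and $tr(g_{n-1}h)=\frac{q^N}{[N]}tr(h)$ for $h\in H_{n-1}$; and for $a,b\in H_n$, $1\le k\le n/2$, $tr(a\bar e_{(k)}b)=\left(\frac{q^{N-1}}{[N]^2}\right)^k tr\big(\Psi_k(\bar e_{(k)}ba\bar e_{(k)})\big)$. It satisfies $tr(cd)=tr(dc)$. *)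

(* Defs.v *)
From HB Require Import structures.
From mathcomp Require Import all_boot all_order all_algebra.
From mathcomp Require Import boolp.

Set Implicit Arguments.
Unset Strict Implicit.
Unset Printing Implicit Defensive.

Import GRing.Theory.
Local Open Scope ring_scope.
Local Open Scope quotient_scope.

(* Q(q) as the fraction field of Z[q]; [ground N] below is its subring
   Z[q, q^-1, [N]^-1], with [qnum] for [N] = (1 - q^N) / (1 - q). *)

Definition ratfrac := {fraction {poly int}}.

HB.instance Definition _ := GRing.Field.on ratfrac.

Definition ratq : ratfrac := FracField.tofrac ('X : {poly int}).

Definition ratqnum (N : int) : ratfrac := (1 - ratq ^ N) / (1 - ratq).

Inductive in_ground (N : int) : ratfrac -> Prop :=
| InGround1 : in_ground N 1
| InGroundq : in_ground N ratq
| InGroundqV : in_ground N ratq^-1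
| InGroundqnumV : in_ground N (ratqnum N)^-1
| InGroundB x y : in_ground N x -> in_ground N y -> in_ground N (x - y)
| InGroundM x y : in_ground N x -> in_ground N y -> in_ground N (x * y).

Definition ground_pred (N : int) : {pred ratfrac} := fun x => `[< in_ground N x >].

Fact ground_subring N : subring_closed (ground_pred N).
Proof.
split=> [|x y /asboolP ? /asboolP ?|x y /asboolP ? /asboolP ?]; apply/asboolP.
- exact: InGround1.
- exact: InGroundB.
- exact: InGroundM.
Qed.

HB.instance Definition _ N :=
  GRing.isSubringClosed.Build ratfrac (ground_pred N) (ground_subring N).

Record ground (N : int) := Ground {
  ground_val :> ratfrac;
  ground_valP : ground_val \in ground_pred N }.

HB.instance Definition _ N := [isSub for @ground_val N].
HB.instance Definition _ N := [Choice of ground N by <:].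
HB.instance Definition _ N := [SubChoice_isSubComNzRing of ground N by <:].

Section GroundUnit.
Variable N : int.

Definition ground_unit : {pred ground N} :=
  fun x => (val x != 0) && ((val x)^-1 \in ground_pred N).

Definition ground_inv (x : ground N) : ground N :=
  if x \in ground_unit then insubd x (val x)^-1 else x.

Fact ground_mulVx : {in ground_unit, left_inverse 1 ground_inv *%R}.
Proof.
move=> x Ux; rewrite /ground_inv Ux; case/andP: Ux => x0 xV.
by apply: val_inj; rewrite rmorphM rmorph1 /= insubdK // mulVf.
Qed.

Fact ground_unitPl (x y : ground N) : y * x = 1 -> ground_unit x.
Proof.
move=> /(congr1 val); rewrite rmorphM rmorph1 /= => yx1.
have x0 : val x != 0.
  by apply: contra_eq_neq yx1 => ->; rewrite mulr0 eq_sym oner_neq0.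
rewrite /ground_unit x0 /= -[_^-1]mul1r -yx1 mulfK //.
exact: valP.
Qed.

Fact ground_invr_out : {in [predC ground_unit], ground_inv =1 id}.
Proof. by move=> x; rewrite inE /ground_inv => /negbTE ->. Qed.

HB.instance Definition _ := GRing.ComNzRing_hasMulInverse.Build (ground N)
  ground_mulVx ground_unitPl ground_invr_out.

HB.instance Definition _ :=
  [SubComUnitRing_isSubIntegralDomain of ground N by <:].

End GroundUnit.

Lemma ratq_neq0 : ratq != 0.
Proof. by rewrite /ratq tofrac_eq0 polyX_eq0. Qed.

Lemma ratqX_neq1 (n : nat) : ratq ^+ n.+1 != 1.
Proof.
rewrite /ratq -tofracXn -tofrac1 tofrac_eq -subr_eq0.
by rewrite -size_poly_eq0 size_XnsubC.
Qed.

Lemma ratqz_neq1 (N : int) : N != 0 -> ratq ^ N != 1.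
Proof.
case: N => [[|n]|n] N0; first by case/eqP: N0.
  exact: ratqX_neq1.
by rewrite NegzE -exprnN -(inj_eq invr_inj) invrK invr1 ratqX_neq1.
Qed.

Lemma ratqnum_neq0 (N : int) : N != 0 -> ratqnum N != 0.
Proof.
move=> N0; apply: mulf_neq0.
  by rewrite subr_eq0 eq_sym ratqz_neq1.
by rewrite invr_eq0 subr_eq0 eq_sym -[ratq]expr1 ratqX_neq1.
Qed.

Fact ratqz_in_ground N (m : int) : ratq ^ m \in ground_pred N.
Proof.
have qX x n : x \in ground_pred N -> x ^+ n \in ground_pred N.
  by move=> Nx; rewrite rpredX.
case: m => n; first by apply: qX; apply/asboolP; apply: InGroundq.
by rewrite NegzE -exprnN -exprVn; apply: qX; apply/asboolP; apply: InGroundqV.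
Qed.

Fact ratqnum_in_ground N m : ratqnum m \in ground_pred N.
Proof.
have q1 : 1 - ratq != 0 by rewrite subr_eq0 eq_sym -[ratq]expr1 ratqX_neq1.
have qn n : ratqnum (Posz n) \in ground_pred N.
  rewrite /ratqnum.
  have -> : 1 - ratq ^ n = (1 - ratq) * (\sum_(i < n) ratq ^+ i).
    rewrite -[LHS]opprB -[1 - ratq]opprB mulNr; congr (- _).
    exact: subrX1.
  rewrite mulrAC mulfV // mul1r rpred_sum // => i _.
  exact: (ratqz_in_ground N i).
case: m => n //; rewrite NegzE.
have -> : ratqnum (- n.+1%:Z) = - (ratq ^ (- n.+1%:Z) * ratqnum n.+1).
  rewrite /ratqnum mulrA -mulNr; congr (_ / _).
  rewrite mulrBr mulr1 -expfzDr ?ratq_neq0 // addNr expr0z.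
  by rewrite opprB.
by rewrite rpredN rpredM ?ratqz_in_ground.
Qed.

Definition q {N} : ground N := Ground (ratqz_in_ground N 1).

Definition qnum {N} : ground N := Ground (ratqnum_in_ground N N).

Lemma q_unit N : (q : ground N) \is a GRing.unit.
Proof.
apply/andP; split; first by rewrite /= expr1z ratq_neq0.
by rewrite /= expr1z; apply/asboolP; apply: InGroundqV.
Qed.

Lemma qnum_unit N : N != 0 -> (qnum : ground N) \is a GRing.unit.
Proof.
move=> N0; apply/andP; split; first exact: ratqnum_neq0.
by apply/asboolP; apply: InGroundqnumV.
Qed.

(* [presalg] below is the unital associative R-algebra given by generators and
   relations: formal expressions modulo the smallest congruence that contains
   the algebra axioms and the relations. *)
Inductive term (R X : Type) :=
| TConst of R
| TGen of X
| TAdd of term R X & term R X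
| TMul of term R X & term R X.

Arguments TGen {R X}.
Arguments TConst {R X}.

Declare Scope term_scope.
Delimit Scope term_scope with T.
Bind Scope term_scope with term.
Notation "s + t" := (TAdd s t) : term_scope.
Notation "s * t" := (TMul s t) : term_scope.
Notation "a %:C" := (TConst a%R) : term_scope.

Fixpoint eval (R : comNzRingType) (X : Type) (A : algType R) (f : X -> A)
    (t : term R X) : A :=
  match t with
  | TConst a => a%:A
  | TGen x => f x
  | TAdd s t => eval f s + eval f t
  | TMul s t => eval f s * eval f t
  end.

Fixpoint bind (R X Y : Type) (f : X -> term R Y) (t : term R X) : term R Y :=
  match t with
  | TConst a => TConst a
  | TGen x => f x
  | TAdd s t => TAdd (bind f s) (bind f t)
  | TMul s t => TMul (bind f s) (bind f t)
  end.

(* The character [paug] plays no role in the algebra presented by [P]; it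
   witnesses that this algebra is nonzero, which MathComp's [algType] needs. *)
Record presentation (R : comNzRingType) := Presentation {
  pgen : Type;
  prel : term R pgen -> term R pgen -> Prop;
  paug : pgen -> R^o;
  paugP : forall s t, prel s t -> eval paug s = eval paug t }.

Section PresentedAlgebra.
Variables (R : comNzRingType) (P : presentation R).
Implicit Types (r s t u : term R (pgen P)) (a b : R).

Inductive pcongr : term R (pgen P) -> term R (pgen P) -> Prop :=
| PRel s t : prel s t -> pcongr s t
| PRefl t : pcongr t t
| PSym s t : pcongr s t -> pcongr t s
| PTrans s t u : pcongr s t -> pcongr t u -> pcongr s u
| PAdd s s' t t' : pcongr s s' -> pcongr t t' -> pcongr (s + t) (s' + t')
| PMul s s' t t' : pcongr s s' -> pcongr t t' -> pcongr (s * t) (s' * t')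
| PAddA s t u : pcongr (s + (t + u)) (s + t + u)
| PAddC s t : pcongr (s + t) (t + s)
| PAdd0 t : pcongr (0%:C + t) t
| PMulA s t u : pcongr (s * (t * u)) (s * t * u)
| PMul1 t : pcongr (1%:C * t) t
| PMul0 t : pcongr (0%:C * t) 0%:C
| PMulDl s t u : pcongr ((s + t) * u) (s * u + t * u)
| PMulDr s t u : pcongr (s * (t + u)) (s * t + s * u)
| PConstC a t : pcongr (a%:C * t) (t * a%:C)
| PConstD a b : pcongr (a + b)%:C (a%:C + b%:C)
| PConstM a b : pcongr (a * b)%:C (a%:C * b%:C).

HB.instance Definition _ := gen_eqMixin (term R (pgen P)).
HB.instance Definition _ := gen_choiceMixin (term R (pgen P)).

Definition pcongrb : rel (term R (pgen P)) := fun s t => `[< pcongr s t >].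

Fact pcongrb_refl : reflexive pcongrb.
Proof. by move=> t; apply/asboolP; apply: PRefl. Qed.

Fact pcongrb_sym : symmetric pcongrb.
Proof. by move=> s t; apply/asboolP/asboolP; apply: PSym. Qed.

Fact pcongrb_trans : transitive pcongrb.
Proof. move=> t s u /asboolP st /asboolP tu; apply/asboolP; exact: PTrans tu. Qed.

Canonical pcongrb_equiv := EquivRel pcongrb pcongrb_refl pcongrb_sym pcongrb_trans.

Definition presalg := {eq_quot pcongrb}.

HB.instance Definition _ : EqQuotient _ pcongrb presalg := EqQuotient.on presalg.
HB.instance Definition _ := Choice.on presalg.

Definition pcls (t : term R (pgen P)) : presalg := \pi t.

Lemma pclsP s t : pcls s = pcls t <-> pcongr s t.
Proof.
split; first by move=> /eqmodP /asboolP.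
by move=> st; apply/eqmodP; apply/asboolP.
Qed.

Lemma pclsK (x : presalg) : pcls (repr x) = x.
Proof. exact: reprK. Qed.

Lemma presalgW (Q : presalg -> Prop) : (forall t, Q (pcls t)) -> forall x, Q x.
Proof. by move=> Qt x; rewrite -(pclsK x). Qed.

Definition pzero : presalg := pcls 0%:C.
Definition pone : presalg := pcls 1%:C.
Definition padd (x y : presalg) : presalg := pcls (repr x + repr y)%T.
Definition pmul (x y : presalg) : presalg := pcls (repr x * repr y)%T.
Definition pscale (a : R) (x : presalg) : presalg := pcls (a%:C * repr x)%T.
Definition popp (x : presalg) : presalg := pscale (-1) x.

Fact repr_pcls t : pcongr (repr (pcls t)) t.
Proof. by apply/pclsP; rewrite pclsK. Qed.

Fact pclsD s t : padd (pcls s) (pcls t) = pcls (s + t).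
Proof. by apply/pclsP/PAdd; apply: repr_pcls. Qed.

Fact pclsM s t : pmul (pcls s) (pcls t) = pcls (s * t).
Proof. by apply/pclsP/PMul; apply: repr_pcls. Qed.

Fact pclsZ a t : pscale a (pcls t) = pcls (a%:C * t).
Proof. by apply/pclsP/PMul; [apply: PRefl | apply: repr_pcls]. Qed.

Let pclsE := (pclsD, pclsM, pclsZ).

Fact paddA : associative padd.
Proof.
elim/presalgW=> s; elim/presalgW=> t; elim/presalgW=> u.
by rewrite !pclsE; apply/pclsP/PAddA.
Qed.

Fact paddC : commutative padd.
Proof.
by elim/presalgW=> s; elim/presalgW=> t; rewrite !pclsE; apply/pclsP/PAddC.
Qed.

Fact padd0 : left_id pzero padd.
Proof. by elim/presalgW=> t; rewrite !pclsE; apply/pclsP/PAdd0. Qed.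

Fact paddN : left_inverse pzero popp padd.
Proof.
elim/presalgW=> t; rewrite /popp !pclsE; apply/pclsP.
apply: (PTrans (t := ((-1)%:C * t + 1%:C * t)%T)).
  by apply: PAdd; [apply: PRefl | apply/PSym/PMul1].
apply: PTrans (PSym (PMulDl _ _ _)) _.
apply: (PTrans (t := (0%:C * t)%T)); last exact: PMul0.
apply: PMul; last exact: PRefl.
by apply: PSym; rewrite -[X in X%:C%T](addNr (1 : R)); apply: PConstD.
Qed.

HB.instance Definition _ := GRing.isZmodule.Build presalg paddA paddC padd0 paddN.

Fact pmulA : associative pmul.
Proof.
elim/presalgW=> s; elim/presalgW=> t; elim/presalgW=> u.
by rewrite !pclsE; apply/pclsP/PMulA.
Qed.

Fact pmul1l : left_id pone pmul.
Proof. by elim/presalgW=> t; rewrite !pclsE; apply/pclsP/PMul1. Qed.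

Fact pmul1r : right_id pone pmul.
Proof.
elim/presalgW=> t; rewrite !pclsE; apply/pclsP.
exact: PTrans (PSym (PConstC _ _)) (PMul1 _).
Qed.

Fact pmulDl : left_distributive pmul padd.
Proof.
elim/presalgW=> s; elim/presalgW=> t; elim/presalgW=> u.
by rewrite !pclsE; apply/pclsP/PMulDl.
Qed.

Fact pmulDr : right_distributive pmul padd.
Proof.
elim/presalgW=> s; elim/presalgW=> t; elim/presalgW=> u.
by rewrite !pclsE; apply/pclsP/PMulDr.
Qed.

Lemma pcongr_eval (A : algType R) (f : pgen P -> A) :
  (forall s t, prel s t -> eval f s = eval f t) ->
  forall s t, pcongr s t -> eval f s = eval f t.
Proof.
move=> fP s t; elim=> {s t} /=.
- exact: fP.
- by [].
- by move=> s t _ ->.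
- by move=> s t u _ -> _ ->.
- by move=> s s' t t' _ -> _ ->.
- by move=> s s' t t' _ -> _ ->.
- by move=> s t u; rewrite addrA.
- by move=> s t; rewrite addrC.
- by move=> t; rewrite scale0r add0r.
- by move=> s t u; rewrite mulrA.
- by move=> t; rewrite scale1r mul1r.
- by move=> t; rewrite scale0r mul0r.
- by move=> s t u; rewrite mulrDl.
- by move=> s t u; rewrite mulrDr.
- by move=> a t; rewrite mulr_algl mulr_algr.
- by move=> a b; rewrite scalerDl.
- by move=> a b; rewrite -scalerAl mul1r scalerA.
Qed.

Fact pone_neq0 : pone != 0.
Proof.
apply/eqP=> /pclsP /(pcongr_eval (@paugP R P)) /eqP.
by rewrite /= scale0r scale1r oner_eq0.
Qed.

HB.instance Definition _ := GRing.Zmodule_isNzRing.Build presalg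
  pmulA pmul1l pmul1r pmulDl pmulDr pone_neq0.

Fact pscaleA a b (x : presalg) : pscale a (pscale b x) = pscale (a * b) x.
Proof.
elim/presalgW: x => t; rewrite !pclsE; apply/pclsP.
apply: PTrans (PMulA _ _ _) _; apply: PMul; last exact: PRefl.
exact/PSym/PConstM.
Qed.

Fact pscale1 : left_id 1 pscale.
Proof. by elim/presalgW=> t; rewrite !pclsE; apply/pclsP/PMul1. Qed.

Fact pscaleDr : right_distributive pscale +%R.
Proof.
move=> a; elim/presalgW=> s; elim/presalgW=> t.
by rewrite [_ + _ in LHS]pclsD !pclsE [RHS]pclsD; apply/pclsP/PMulDr.
Qed.

Fact pscaleDl (x : presalg) : {morph pscale^~ x : a b / a + b}.
Proof.
move=> a b; elim/presalgW: x => t; rewrite !pclsE [RHS]pclsD; apply/pclsP.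
apply: PTrans _ (PMulDl _ _ _); apply: PMul; last exact: PRefl.
exact: PConstD.
Qed.

HB.instance Definition _ := GRing.Zmodule_isLmodule.Build R presalg
  pscaleA pscale1 pscaleDr pscaleDl.

Fact pscaleAl a (x y : presalg) : a *: (x * y) = a *: x * y.
Proof.
elim/presalgW: x => s; elim/presalgW: y => t.
rewrite [_ * _ in LHS]pclsM [LHS]pclsZ [_ *: _]pclsZ [RHS]pclsM.
exact/pclsP/PMulA.
Qed.

HB.instance Definition _ := GRing.Lmodule_isLalgebra.Build R presalg pscaleAl.

Fact pscaleAr a (x y : presalg) : a *: (x * y) = x * (a *: y).
Proof.
elim/presalgW: x => s; elim/presalgW: y => t.
rewrite [_ * _ in LHS]pclsM [LHS]pclsZ [_ *: _]pclsZ [RHS]pclsM.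
apply/pclsP; apply: PTrans (PMulA _ _ _) _; apply: PTrans _ (PSym (PMulA _ _ _)).
by apply: PMul; [apply: PConstC | apply: PRefl].
Qed.

HB.instance Definition _ := GRing.Lalgebra_isAlgebra.Build R presalg pscaleAr.

Lemma pcls_add s t : pcls (s + t) = pcls s + pcls t.
Proof. by rewrite [RHS]pclsD. Qed.

Lemma pcls_mul s t : pcls (s * t) = pcls s * pcls t.
Proof. by rewrite [RHS]pclsM. Qed.

Lemma pcls_const a : pcls a%:C = a%:A.
Proof.
rewrite [RHS]pclsZ; apply/pclsP; apply: PTrans _ (PConstC _ _).
exact/PSym/PMul1.
Qed.

Lemma pcls_eval t : pcls t = eval (fun x => pcls (TGen x)) t.
Proof.
elim: t => [a|x|s IHs t IHt|s IHs t IHt] //=.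
- exact: pcls_const.
- by rewrite -IHs -IHt pcls_add.
- by rewrite -IHs -IHt pcls_mul.
Qed.

Section Lift.
Variables (A : algType R) (f : pgen P -> A).
Hypothesis fP : forall s t, prel s t -> eval f s = eval f t.

Definition plift (_ : forall s t, prel s t -> eval f s = eval f t)
  (x : presalg) : A := eval f (repr x).

Lemma plift_pcls t : plift fP (pcls t) = eval f t.
Proof. exact/(pcongr_eval fP)/repr_pcls. Qed.

Fact plift_linear : linear (plift fP).
Proof.
move=> a; elim/presalgW=> s; elim/presalgW=> t.
rewrite [_ *: _]pclsZ [_ + _ in LHS]pclsD !plift_pcls /=.
by rewrite -scalerAl mul1r.
Qed.

HB.instance Definition _ := GRing.isLinear.Build R presalg A *:%R (plift fP)
  plift_linear.

Fact plift_monoid : monoid_morphism (plift fP).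
Proof.
split=> [|]; first by rewrite plift_pcls /= scale1r.
by elim/presalgW=> s; elim/presalgW=> t; rewrite [_ * _ in LHS]pclsM !plift_pcls.
Qed.

HB.instance Definition _ := GRing.isMonoidMorphism.Build presalg A (plift fP)
  plift_monoid.

End Lift.
End PresentedAlgebra.

Arguments pcls {R P}.

Lemma eval_bind (R : comNzRingType) (P : presentation R) (X : Type)
    (f : X -> term R (pgen P)) (t : term R X) :
  eval (fun x => pcls (f x)) t = pcls (bind f t).
Proof.
rewrite pcls_eval; elim: t => [a|x|s IHs t IHt|s IHs t IHt] //=.
- by rewrite -pcls_eval.
- by rewrite IHs IHt.
- by rewrite IHs IHt.
Qed.

(* [Lg i] names the generator g_i and [Le] the generator e. *)
Inductive letter := Lg of nat | Le.

Definition Hletter (n : nat) (x : letter) : bool :=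
  if x is Lg i then (0 < i < n)%N else false.

Definition Brletter (n : nat) (x : letter) : bool :=
  if x is Lg i then (0 < i < n)%N else (1 < n)%N.

(* A letter that is not a generator is read as 0. *)
Definition tletter (R : comNzRingType) (V : pred letter) (x : letter) :
    term R {y : letter | V y} :=
  if insub x is Some y then TGen y else (0 : R)%:C.

Section Relations.
Variables (N : int) (X : Type) (n : nat).
Variables (g : nat -> term (ground N) X) (e : term (ground N) X).
Local Open Scope term_scope.

(* g_i^-1, obtained by solving the quadratic relation *)
Definition tginv (i : nat) : term (ground N) X :=
  (q^-1)%:C * g i + (q^-1 - 1)%:C.

Inductive Hrel : term (ground N) X -> term (ground N) X -> Prop :=
| Hrel_braid i : (0 < i)%N -> (i.+1 < n)%N ->
    Hrel (g i * g i.+1 * g i) (g i.+1 * g i * g i.+1)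
| Hrel_comm i j : (0 < i)%N -> (i.+1 < j)%N -> (j < n)%N ->
    Hrel (g i * g j) (g j * g i)
| Hrel_quad i : (0 < i < n)%N ->
    Hrel (g i * g i) ((q - 1)%:C * g i + q%:C).

Definition te2 : term (ground N) X :=
  e * (g 2 * g 3 * tginv 1 * tginv 2) * e.

Inductive Brrel : term (ground N) X -> term (ground N) X -> Prop :=
| Brrel_H s t : Hrel s t -> Brrel s t
| Brrel_ee : (1 < n)%N -> Brrel (e * e) (qnum%:C * e)
| Brrel_eg i : (2 < i < n)%N -> Brrel (e * g i) (g i * e)
| Brrel_eg1 : (1 < n)%N -> Brrel (e * g 1) (q%:C * e)
| Brrel_g1e : (1 < n)%N -> Brrel (g 1 * e) (q%:C * e)
| Brrel_eg2e : (2 < n)%N -> Brrel (e * g 2 * e) ((q ^ N)%:C * e)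
| Brrel_eg2Ve : (2 < n)%N -> Brrel (e * tginv 2 * e) ((q^-1)%:C * e)
| Brrel_e2l : (3 < n)%N ->
    Brrel (g 2 * g 3 * tginv 1 * tginv 2 * te2) te2
| Brrel_e2r : (3 < n)%N ->
    Brrel (te2 * (g 2 * g 3 * tginv 1 * tginv 2)) te2.

End Relations.

Section Bind.
Variables (N : int) (X Y : Type) (f : X -> term (ground N) Y) (n n' : nat).
Variables (g : nat -> term (ground N) X) (e : term (ground N) X).
Variables (g' : nat -> term (ground N) Y) (e' : term (ground N) Y).
Hypothesis le_nn' : (n <= n')%N.
Hypothesis fg : forall i, (0 < i < n)%N -> bind f (g i) = g' i.
Hypothesis fe : (1 < n)%N -> bind f e = e'.

Lemma Hrel_bind s t : Hrel n g s t -> Hrel n' g' (bind f s) (bind f t).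
Proof.
case=> [i i0 ilt|i j i0 ij jn|i ilt] /=.
- rewrite !fg ?i0 ?(ltnW ilt) //; apply: Hrel_braid => //.
  exact: leq_trans ilt _.
- have ltin : (i < n)%N by apply: ltn_trans jn; apply: ltnW.
  rewrite !fg ?i0 // ?jn ?andbT; last by case: (j) ij.
  by apply: Hrel_comm => //; apply: leq_trans jn _.
- rewrite !fg //; apply: Hrel_quad.
  by case/andP: ilt => -> ilt; apply: leq_trans ilt _.
Qed.

Lemma Brrel_bind s t :
  Brrel n g e s t -> Brrel n' g' e' (bind f s) (bind f t).
Proof.
have lt_trans k : (k < n)%N -> (k < n')%N by move/leq_trans; apply.
have f2 : (1 < n)%N -> bind f (g 1) = g' 1%N by move=> ?; rewrite fg.
have f3 : (2 < n)%N -> bind f (g 2) = g' 2%N by move=> ?; rewrite fg.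
have f4 : (3 < n)%N -> bind f (g 3) = g' 3%N by move=> ?; rewrite fg.
case=> [{}s {}t /Hrel_bind|n1|i /andP[i2 ilt]|n1|n1|n2|n2|n3|n3] /=.
- exact: Brrel_H.
- by rewrite fe //; apply/Brrel_ee/lt_trans.
- have n1 : (1 < n)%N by apply: ltn_trans ilt; apply: ltnW.
  rewrite fe // fg ?ilt ?andbT; last by case: (i) i2.
  by apply: Brrel_eg; rewrite i2 lt_trans.
- by rewrite fe // f2 //; apply/Brrel_eg1/lt_trans.
- by rewrite fe // f2 //; apply/Brrel_g1e/lt_trans.
- by rewrite fe ?f3 ?(ltnW n2) //; apply/Brrel_eg2e/lt_trans.
- by rewrite fe ?f3 ?(ltnW n2) //; apply/Brrel_eg2Ve/lt_trans.
- have n2 := ltnW n3; have n1 := ltnW n2.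
  by rewrite fe ?f2 ?f3 ?f4 //; apply/Brrel_e2l/lt_trans.
- have n2 := ltnW n3; have n1 := ltnW n2.
  by rewrite fe ?f2 ?f3 ?f4 //; apply/Brrel_e2r/lt_trans.
Qed.

End Bind.

Section Algebras.
Variable N : int.

Definition HtermG n (i : nat) : term (ground N) {x | Hletter n x} :=
  tletter _ (Hletter n) (Lg i).
Definition BrtermG n (i : nat) : term (ground N) {x | Brletter n x} :=
  tletter _ (Brletter n) (Lg i).
Definition BrtermE n : term (ground N) {x | Brletter n x} :=
  tletter _ (Brletter n) Le.

(* the character g_i |-> q, e |-> 0 *)
Definition letter_char (V : pred letter) (x : {y : letter | V y}) :
  (ground N)^o := if val x is Lg _ then q else 0.

Fact eval_Lg (V : pred letter) i : V (Lg i) ->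
  eval (@letter_char V) (tletter _ V (Lg i)) = q.
Proof. by move=> Vi; rewrite /tletter insubT. Qed.

Fact eval_Le (V : pred letter) :
  eval (@letter_char V) (tletter _ V Le) = 0.
Proof. by rewrite /tletter; case: insubP => [x _ xe|_] /=;
  rewrite /letter_char ?xe ?scale0r. Qed.

Fact Hrel_char n (V : pred letter) : (forall i, (0 < i < n)%N -> V (Lg i)) ->
  forall s t, Hrel n (fun i => tletter _ V (Lg i)) s t ->
  eval (@letter_char V) s = eval (@letter_char V) t.
Proof.
move=> VP s t [i i0 ilt|i j i0 ij jn|i ilt] /=.
- by rewrite !eval_Lg // VP ?i0 ?(ltnW ilt) //.
- by rewrite mulrC.
- rewrite !eval_Lg ?VP //.
  have rA (a : ground N) : a%:A = a :> (ground N)^o by exact: mulr1.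
  by rewrite !rA mulrBl mul1r subrK.
Qed.

Fact HcharP n s t : Hrel n (HtermG n) s t ->
  eval (@letter_char (Hletter n)) s = eval (@letter_char (Hletter n)) t.
Proof. exact: Hrel_char. Qed.

Fact BrcharP n s t : Brrel n (BrtermG n) (BrtermE n) s t ->
  eval (@letter_char (Brletter n)) s = eval (@letter_char (Brletter n)) t.
Proof.
case=> [{}s {}t /Hrel_char|?|i _|?|?|?|?|?|?] /=; first exact.
all: by rewrite eval_Le !(mulr0, mul0r).
Qed.

Definition Hpres n := Presentation (@HcharP n).
Definition Brpres n := Presentation (@BrcharP n).

Definition H n : Type := presalg (Hpres n).
Definition Br n : Type := presalg (Brpres n).

HB.instance Definition _ n := GRing.Algebra.on (H n).
HB.instance Definition _ n := GRing.Algebra.on (Br n).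

(* [Hg n i] and [g n i] are the generator g_i for 1 <= i < n, and [e n] is the
   generator e for 2 <= n; outside these ranges the values are 0. *)
Definition Hg n (i : nat) : H n := @pcls _ (Hpres n) (HtermG n i).
Definition g n (i : nat) : Br n := @pcls _ (Brpres n) (BrtermG n i).
Definition e n : Br n := @pcls _ (Brpres n) (BrtermE n).

Definition ginv n (i : nat) : Br n := q^-1 *: g n i + (q^-1 - 1)%:A.

Lemma g_quad n i : (0 < i < n)%N -> g n i * g n i = (q - 1) *: g n i + q%:A.
Proof.
move=> ilt.
have : @pcongr _ (Brpres n) _ _ :=
  PRel (P := Brpres n) (Brrel_H (BrtermE n) (Hrel_quad (BrtermG n) ilt)).
by move=> /pclsP; rewrite pcls_add !pcls_mul !pcls_const mulr_algl.
Qed.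

Lemma g_mulrV n i : (0 < i < n)%N -> g n i * ginv n i = 1.
Proof.
move=> ilt; rewrite /ginv mulrDr -scalerAr g_quad // mulr_algr scalerDr !scalerA.
rewrite mulVr ?q_unit // addrAC -scalerDl mulrBr mulVr ?q_unit // mulr1.
by rewrite -[q^-1 - 1]opprB subrr scale0r add0r scale1r.
Qed.

Lemma g_mulVr n i : (0 < i < n)%N -> ginv n i * g n i = 1.
Proof.
move=> ilt; rewrite -(g_mulrV ilt) /ginv mulrDl mulrDr.
by rewrite -scalerAl -scalerAr mulr_algl mulr_algr.
Qed.

Fact bind_tletter (V V' : pred letter) x : V x ->
  bind (fun y : {y | V y} => tletter (ground N) V' (val y))
    (tletter _ V x) = tletter _ V' x.
Proof. by move=> Vx; rewrite {2}/tletter insubT. Qed.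

Definition HtoH_gen n (x : {x | Hletter n x}) : H n.+1 :=
  @pcls _ (Hpres n.+1) (tletter _ (Hletter n.+1) (val x)).

Fact HtoH_rel n s t :
  @prel _ (Hpres n) s t -> eval (@HtoH_gen n) s = eval (@HtoH_gen n) t.
Proof.
move=> st; rewrite !(@eval_bind _ (Hpres n.+1)); apply/pclsP/PRel.
apply: Hrel_bind st => // i ilt; exact: bind_tletter.
Qed.

Definition HtoBr_gen n (x : {x | Hletter n x}) : Br n :=
  @pcls _ (Brpres n) (tletter _ (Brletter n) (val x)).

Fact HtoBr_rel n s t :
  @prel _ (Hpres n) s t -> eval (@HtoBr_gen n) s = eval (@HtoBr_gen n) t.
Proof.
move=> st; rewrite !(@eval_bind _ (Brpres n)); apply/pclsP/PRel/Brrel_H.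
apply: Hrel_bind st => // i ilt; exact: bind_tletter.
Qed.

Definition BrtoBr_gen n (x : {x | Brletter n x}) : Br n.+1 :=
  @pcls _ (Brpres n.+1) (tletter _ (Brletter n.+1) (val x)).

Fact BrtoBr_rel n s t :
  @prel _ (Brpres n) s t -> eval (@BrtoBr_gen n) s = eval (@BrtoBr_gen n) t.
Proof.
move=> st; rewrite !(@eval_bind _ (Brpres n.+1)); apply/pclsP/PRel.
apply: Brrel_bind st => // [i ilt|n1]; exact: bind_tletter.
Qed.

(* The maps H_n -> H_(n+1), H_n -> Br_n(N) and Br_n(N) -> Br_(n+1)(N) that send
   each generator to the generator of the same name. *)
Definition HtoH n : {lrmorphism H n -> H n.+1} := plift (@HtoH_rel n).
Definition HtoBr n : {lrmorphism H n -> Br n} := plift (@HtoBr_rel n).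
Definition BrtoBr n : {lrmorphism Br n -> Br n.+1} := plift (@BrtoBr_rel n).

Lemma HtoH_g n i : (0 < i < n)%N -> HtoH n (Hg n i) = Hg n.+1 i.
Proof.
move=> ilt; rewrite [LHS]plift_pcls (@eval_bind _ (Hpres n.+1)).
by congr pcls; apply: bind_tletter.
Qed.

Lemma HtoBr_g n i : (0 < i < n)%N -> HtoBr n (Hg n i) = g n i.
Proof.
move=> ilt; rewrite [LHS]plift_pcls (@eval_bind _ (Brpres n)).
by congr pcls; apply: bind_tletter.
Qed.

Lemma BrtoBr_g n i : (0 < i < n)%N -> BrtoBr n (g n i) = g n.+1 i.
Proof.
move=> ilt; rewrite [LHS]plift_pcls (@eval_bind _ (Brpres n.+1)).
by congr pcls; apply: bind_tletter.
Qed.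

Lemma BrtoBr_e n : (1 < n)%N -> BrtoBr n (e n) = e n.+1.
Proof.
move=> n1; rewrite [LHS]plift_pcls (@eval_bind _ (Brpres n.+1)).
by congr pcls; apply: bind_tletter.
Qed.

(* e_(k); meaningful when 2k <= n *)
Fixpoint ek n (k : nat) : Br n :=
  if k is k'.+1 then
    e n * (\prod_(2 <= i < k'.*2.+2) g n i)
        * (\prod_(1 <= i < k'.*2.+1) ginv n i) * ek n k'
  else 1.

Definition ebar n : Br n := qnum^-1 *: e n.

Definition ebark n (k : nat) : Br n := qnum^-1 ^+ k *: ek n k.

Definition corner (A : algType (ground N)) (p x : A) : Prop :=
  exists y, x = p * y * p.

(* With n = m + 2k: [psi], restricted to the corner of the idempotent ebar_(k)
   of Br_n(N), is the algebra isomorphism Psi_k onto Br_(n-2k)(N).  The values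
   of [psi] outside the corner are arbitrary. *)
Record is_Psi (k m : nat) (psi : Br (m + k.*2) -> Br m) : Prop := IsPsi {
  PsiZD : forall (a : ground N) x y,
    corner (ebark (m + k.*2) k) x -> corner (ebark (m + k.*2) k) y ->
    psi (a *: x + y) = a *: psi x + psi y;
  PsiM : forall x y,
    corner (ebark (m + k.*2) k) x -> corner (ebark (m + k.*2) k) y ->
    psi (x * y) = psi x * psi y;
  Psi1 : psi (ebark (m + k.*2) k) = 1;
  Psi_inj : forall x y,
    corner (ebark (m + k.*2) k) x -> corner (ebark (m + k.*2) k) y ->
    psi x = psi y -> x = y;
  Psi_surj : forall z, exists2 x, corner (ebark (m + k.*2) k) x & psi x = z;
  Psi_g : forall i, (k.*2 < i < m + k.*2)%N ->
    psi (ebark (m + k.*2) k * g (m + k.*2) i) = g m (i - k.*2);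
  Psi_e : (1 < m)%N -> psi (ebark (m + k.*2) k.+1) = ebar m }.

(* The Markov trace, as a compatible family of functionals on the H_n. *)
Record is_Markov (t : forall n, H n -> ground N) : Prop := IsMarkov {
  Markov1 : forall n, t n 1 = 1;
  MarkovC : forall n x y, t n (x * y) = t n (y * x);
  Markov_incl : forall n h, t n.+1 (HtoH n h) = t n h;
  Markov_g : forall n h, (0 < n)%N ->
    t n.+1 (Hg n.+1 n * HtoH n h) = q ^ N / qnum * t n h }.

Record is_tr (Psi : forall k m, Br (m + k.*2) -> Br m)
    (tr : forall n, {scalar Br n}) : Prop := IsTr {
  tr_Markov : is_Markov (fun n h => tr n (HtoBr n h));
  tr_ebark : forall k m (a b : H (m + k.*2)), (0 < k)%N ->
    let f := ebark (m + k.*2) k in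
    tr (m + k.*2)%N (HtoBr _ a * f * HtoBr _ b) =
      (q ^ (N - 1) / qnum ^+ 2) ^+ k *
      tr m (Psi k m (f * (HtoBr _ b * HtoBr _ a) * f)) }.

End Algebras.

(* Main.v *)
From HB Require Import structures.
From Pilot Require Import Defs.
From mathcomp Require Import all_boot all_order all_algebra.
From mathcomp Require Import boolp zify ring.

(* Write A_n for Br_n(N), z = q^N / [N] and kappa = q^(N-1) / [N]^2.  Inverting
   Psi_1 gives a multiplicative embedding theta : A_(n-2) -> ebar A_n ebar with
   theta 1 = ebar, and theta (ebar_(k)) = ebar_(k+1).  Since ebar A_n ebar is the
   image of theta, A_n = H_n + H_n theta(A_(n-2)) H_n, so all elements
   a ebar_(k) b span A_n, and by induction on n the functional tr satisfies
   tr (a theta(y) b) = kappa tr (y theta^-1(ebar b a ebar)).  It follows that tr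
   is a trace, that it is compatible with A_n -> A_(n+1), and that
   tr (theta y) = kappa tr y.

   The Markov property tr (c g_n) = z tr c is proved by strong induction on n.
   - If c = a ebar w or c = w ebar a with a in H_(n-1), then g_n commutes with a
     and ebar, everything can be rotated into the corner of ebar, and the claim
     is the one for n - 2.
   - Let v = g_2 ... g_(n-1).  By a coset decomposition of H_n the only other c
     are h v^-1 theta(y) v h' with h, h' in H_(n-1).  The relation on e_(2) brings
     those with y in H ebar A_(n-2) back to the first case, so only c = f h with
     f = v^-1 ebar v and h in H_(n-1) remains.
   - Since f commutes with g_2, ..., g_(n-2), h is u or g_1 u with u generated by
     them, and these cases are computed from
     ebar v g_n v^-1 ebar = z ebar and
     ebar v g_n g_1 v^-1 ebar = q theta(f') + (q - 1) z ebar,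
     where f' is the analogue of f in A_(n-1), for which tr (f' w) = kappa tr w
     whenever w is in H_(n-2). *)

Set Implicit Arguments.
Unset Strict Implicit.
Unset Printing Implicit Defensive.

Import GRing.Theory.
Local Open Scope ring_scope.

(** * Relations of the q-Brauer algebra *)

Section Generators.
Variable N : int.
Local Notation g := (@Defs.g N).
Local Notation e := (@Defs.e N).
Local Notation ginv := (@Defs.ginv N).
Local Notation Br := (@Defs.Br N).
Local Notation H := (@Defs.H N).
Local Notation Hg := (@Defs.Hg N).
Local Notation qnum := (@Defs.qnum N).
Local Notation q := (@Defs.q N).

(** Every element is a formal expression applied to 1, so stability under left multiplication by the
    generators is enough. *)
Lemma Br_ind n (Q : Br n -> Prop) :
  Q 1 -> (forall x y, Q x -> Q y -> Q (x + y)) ->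
  (forall a x, Q x -> Q (a *: x)) ->
  (forall i x, (0 < i < n)%N -> Q x -> Q (g n i * x)) ->
  ((1 < n)%N -> forall x, Q x -> Q (e n * x)) ->
  forall x, Q x.
Proof.
move=> Q1 QD QZ Qg Qe; have K t x : Q x -> Q (@pcls _ (Brpres N n) t * x).
  elim: t x => [a|[[i|] V]|s IHs t IHt|s IHs t IHt] x Qx.
  - by rewrite pcls_const mulr_algl; apply: QZ.
  - have -> : @pcls _ (Brpres N n) (TGen (exist _ (Lg i) V)) = g n i.
      by rewrite /Defs.g /BrtermG /tletter insubT.
    exact: Qg.
  - have -> : @pcls _ (Brpres N n) (TGen (exist _ Le V)) = e n.
      by rewrite /Defs.e /BrtermE /tletter insubT.
    exact: Qe.
  - by rewrite pcls_add mulrDl; apply: QD; [apply: IHs | apply: IHt].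
  - by rewrite pcls_mul -mulrA; apply/IHs/IHt.
by elim/presalgW=> t; rewrite -[pcls t]mulr1; apply: K.
Qed.

Lemma H_ind n (Q : H n -> Prop) :
  Q 1 -> (forall x y, Q x -> Q y -> Q (x + y)) ->
  (forall a x, Q x -> Q (a *: x)) ->
  (forall i x, (0 < i < n)%N -> Q x -> Q (Hg n i * x)) ->
  forall x, Q x.
Proof.
move=> Q1 QD QZ Qg; have K t x : Q x -> Q (@pcls _ (Hpres N n) t * x).
  elim: t x => [a|[[i|] V]|s IHs t IHt|s IHs t IHt] x Qx.
  - by rewrite pcls_const mulr_algl; apply: QZ.
  - have -> : @pcls _ (Hpres N n) (TGen (exist _ (Lg i) V)) = Hg n i.
      by rewrite /Defs.Hg /HtermG /tletter insubT.
    exact: Qg.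
  - by [].
  - by rewrite pcls_add mulrDl; apply: QD; [apply: IHs | apply: IHt].
  - by rewrite pcls_mul -mulrA; apply/IHs/IHt.
by elim/presalgW=> t; rewrite -[pcls t]mulr1; apply: K.
Qed.

Local Notation pc n := (@pcls _ (Brpres N n)).

Lemma pcls_rel n s t : Brrel n (BrtermG N n) (BrtermE N n) s t -> pc n s = pc n t.
Proof. by move=> st; apply/pclsP/PRel. Qed.

Lemma pcls_ginv n i : pc n (tginv (BrtermG N n) i) = ginv n i.
Proof. by rewrite pcls_add pcls_mul !pcls_const mulr_algl. Qed.

Lemma g_braid n i : (0 < i)%N -> (i.+1 < n)%N ->
  g n i * g n i.+1 * g n i = g n i.+1 * g n i * g n i.+1.
Proof.
move=> i0 ilt; have := pcls_rel (Brrel_H _ (Hrel_braid (BrtermG N n) i0 ilt)).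
by rewrite !pcls_mul.
Qed.

Lemma g_comm n i j : (0 < i)%N -> (i.+1 < j)%N -> (j < n)%N ->
  g n i * g n j = g n j * g n i.
Proof.
move=> i0 ij jn; have := pcls_rel (Brrel_H _ (Hrel_comm (BrtermG N n) i0 ij jn)).
by rewrite !pcls_mul.
Qed.

Lemma e_sq n : (1 < n)%N -> e n * e n = qnum *: e n.
Proof.
move=> n1; have := pcls_rel (Brrel_ee (BrtermG N n) _ n1).
by rewrite !pcls_mul pcls_const mulr_algl.
Qed.

Lemma e_g n i : (2 < i < n)%N -> e n * g n i = g n i * e n.
Proof.
move=> n1; have := pcls_rel (Brrel_eg (BrtermG N n) _ n1).
by rewrite !pcls_mul.
Qed.

Lemma e_g1 n : (1 < n)%N -> e n * g n 1 = q *: e n.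
Proof.
move=> n1; have := pcls_rel (Brrel_eg1 (BrtermG N n) _ n1).
by rewrite !pcls_mul pcls_const mulr_algl.
Qed.

Lemma g1_e n : (1 < n)%N -> g n 1 * e n = q *: e n.
Proof.
move=> n1; have := pcls_rel (Brrel_g1e (BrtermG N n) _ n1).
by rewrite !pcls_mul pcls_const mulr_algl.
Qed.

Lemma e_g2_e n : (2 < n)%N -> e n * g n 2 * e n = (q ^ N) *: e n.
Proof.
move=> n1; have := pcls_rel (Brrel_eg2e (BrtermG N n) _ n1).
by rewrite !pcls_mul pcls_const mulr_algl.
Qed.

Lemma e2_absl n : (3 < n)%N ->
  let e2 := e n * (g n 2 * g n 3 * ginv n 1 * ginv n 2) * e n in
  g n 2 * g n 3 * ginv n 1 * ginv n 2 * e2 = e2.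
Proof.
move=> n1; have := pcls_rel (Brrel_e2l (BrtermG N n) (BrtermE N n) n1).
by rewrite !pcls_mul !pcls_ginv.
Qed.

End Generators.

(** [zeta] is z, the trace of every g_n, and [kappa] is the trace of ebar. *)
HB.lock Definition zeta N : ground N := q ^ N / qnum.
HB.lock Definition kappa N : ground N := q ^ (N - 1) / qnum ^+ 2.

Section Scalars.
Variables (N : int).
Local Notation qnum := (@Defs.qnum N).
Local Notation q := (@Defs.q N).

Local Notation zeta := (@zeta N).
Local Notation kappa := (@kappa N).

Lemma q_kappa : q * kappa = q ^ N / qnum ^+ 2.
Proof.
by rewrite kappa.unlock mulrA -{1}[q]expr1z -exprzDr ?q_unit // addrC subrK.
Qed.

Lemma q1_qnum : (q - 1) * qnum = q ^ N - 1.
Proof.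
have vq : val q = ratq by rewrite /= expr1z.
have vX : val (q ^ N) = ratq ^ N by rewrite -vq; apply: rmorphXz (q_unit N).
apply: val_inj; rewrite rmorphM !rmorphB rmorph1.
have nz : 1 - ratq != 0 by rewrite subr_eq0 eq_sym -[ratq]expr1 ratqX_neq1.
transitivity ((ratq - 1) * ratqnum N); first by rewrite -vq.
transitivity (ratq ^ N - 1); last by rewrite -vX.
by rewrite /ratqnum -[ratq - 1]opprB mulNr mulrCA mulfV // mulr1 opprB.
Qed.

(** Substituting q - 1 = (q^N - 1) / [N] makes the terms in q^N cancel and leaves q^(2N) / [N]^2.
    This identity closes the case c = f g_1 u. *)
Lemma zeta_sq (hN : N != 0) : q * kappa + (q - 1) * zeta = zeta ^+ 2.
Proof.
have -> : q - 1 = (q ^ N - 1) * qnum^-1 by rewrite -q1_qnum mulrK ?qnum_unit.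
by rewrite q_kappa zeta.unlock -exprVn; ring.
Qed.

End Scalars.

(* The definitions below are sealed: their bodies are sums and products, which
   rewriting with ring laws would otherwise expose. *)
HB.lock Definition gV N n i : Br N n := Defs.ginv N n i.
HB.lock Definition eb N n : Br N n := Defs.ebar N n.
HB.lock Definition ebk N n k : Br N n := Defs.ebark N n k.

(** The word in the definition of e_(2), shifted by 2l: the strands 2l + 1 and 2l + 2 cross the next
    two. *)
HB.lock Definition cup N n l : Br N n :=
  g N n l.*2.+2 * g N n l.*2.+3 * gV N n l.*2.+1 * gV N n l.*2.+2.

Section BrauerAlgebra.
Variables (N : int).
Local Notation g := (@Defs.g N).
Local Notation e := (@Defs.e N).
Local Notation ginv := (@gV N).
Local Notation ebar := (@eb N).
Local Notation Br := (@Defs.Br N).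
Local Notation ebark := (@ebk N).
Local Notation q := (@Defs.q N).
Local Notation zeta := (@zeta N).

Lemma commrZ n (x y : Br n) a : GRing.comm x y -> GRing.comm x (a *: y).
Proof. by move=> xy; rewrite /GRing.comm -scalerAl -scalerAr xy. Qed.

Lemma gVE n i : ginv n i = q^-1 *: g n i + (q^-1 - 1)%:A.
Proof. by rewrite gV.unlock. Qed.

Lemma gmulrV n i : (0 < i < n)%N -> g n i * ginv n i = 1.
Proof. by rewrite gV.unlock; apply: g_mulrV. Qed.

Lemma gmulVr n i : (0 < i < n)%N -> ginv n i * g n i = 1.
Proof. by rewrite gV.unlock; apply: g_mulVr. Qed.

Lemma commr_ginv n i (x : Br n) : GRing.comm x (g n i) -> GRing.comm x (ginv n i).
Proof.
by move=> xg; rewrite gVE; apply: commrD; [apply: commrZ | apply: commrZ; apply: commr1].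
Qed.

Lemma mul_gVK n i x : (0 < i < n)%N -> ginv n i * (g n i * x) = x.
Proof. by move=> ilt; rewrite mulrA gmulVr // mul1r. Qed.

Lemma mul_gK n i x : (0 < i < n)%N -> g n i * (ginv n i * x) = x.
Proof. by move=> ilt; rewrite mulrA gmulrV // mul1r. Qed.

Lemma mulr_gK n i x : (0 < i < n)%N -> x * g n i * ginv n i = x.
Proof. by move=> ilt; rewrite -mulrA gmulrV // mulr1. Qed.

Lemma gE n i : g n i = q *: ginv n i + (q - 1)%:A.
Proof.
rewrite gVE scalerDr !scalerA mulrV ?q_unit // scale1r -addrA -scalerDl.
by rewrite mulrBr mulrV ?q_unit // mulr1 -[q - 1]opprB subrr scale0r addr0.
Qed.

Lemma gg_comm n i j : (0 < i < n)%N -> (0 < j < n)%N -> ((i.+1 < j) || (j.+1 < i))%N ->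
  GRing.comm (g n i) (g n j).
Proof.
move=> /andP[i0 iN] /andP[j0 jN] /orP[] ij; first exact: g_comm.
by apply/commr_sym/g_comm.
Qed.

(** This and [conj_g] turn a conjugation by g_2, which does not commute with ebar, into one by g_3
    or g_1, which does. *)
Lemma conj_gS n i : (0 < i)%N -> (i.+1 < n)%N ->
  g n i * g n i.+1 * ginv n i = ginv n i.+1 * g n i * g n i.+1.
Proof.
move=> i0 iN; have iN' : (0 < i < n)%N by rewrite i0 ltnW.
transitivity (ginv n i.+1 * (g n i.+1 * g n i * g n i.+1) * ginv n i).
  by rewrite -!(mulrA (g n i.+1)) mul_gVK.
by rewrite -g_braid // !mulrA mulr_gK.
Qed.

Lemma conj_g n i : (0 < i)%N -> (i.+1 < n)%N ->
  g n i.+1 * g n i * ginv n i.+1 = ginv n i * g n i.+1 * g n i.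
Proof.
move=> i0 iN; have iN' : (0 < i < n)%N by rewrite i0 ltnW.
transitivity (ginv n i * (g n i * g n i.+1 * g n i) * ginv n i.+1).
  by rewrite -!(mulrA (g n i)) mul_gVK.
by rewrite g_braid // !mulrA mulr_gK.
Qed.

Lemma ebar_idem (hN : N != 0) n : (1 < n)%N -> ebar n * ebar n = ebar n.
Proof.
move=> n1; rewrite eb.unlock /Defs.ebar -scalerAl -scalerAr e_sq // !scalerA.
by rewrite -mulrA mulVr ?qnum_unit // mulr1.
Qed.

Lemma e_ebar (hN : N != 0) n : e n = qnum *: ebar n.
Proof. by rewrite eb.unlock /Defs.ebar scalerA mulrV ?qnum_unit // scale1r. Qed.

Lemma ebar_g1 n : (1 < n)%N -> ebar n * g n 1 = q *: ebar n.
Proof. by move=> n1; rewrite eb.unlock /Defs.ebar -scalerAl e_g1 // !scalerA mulrC. Qed.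

Lemma g1_ebar n : (1 < n)%N -> g n 1 * ebar n = q *: ebar n.
Proof. by move=> n1; rewrite eb.unlock /Defs.ebar -scalerAr g1_e // !scalerA mulrC. Qed.

Lemma ebar_comm n i : (0 < i < n)%N -> i != 2 -> GRing.comm (ebar n) (g n i).
Proof.
case: i => [|[|[|i]]] //= ilt _; rewrite /GRing.comm; first by rewrite ebar_g1 ?g1_ebar.
by rewrite eb.unlock /Defs.ebar -scalerAl -scalerAr e_g.
Qed.

Lemma ebar_commV n i : (0 < i < n)%N -> i != 2 -> GRing.comm (ebar n) (ginv n i).
Proof. by move=> iN i2; apply/commr_ginv/ebar_comm. Qed.

Lemma ebar_g2 n : (2 < n)%N -> ebar n * g n 2 * ebar n = zeta *: ebar n.
Proof.
move=> n2; rewrite eb.unlock /Defs.ebar -!scalerAl -!scalerAr e_g2_e // !scalerA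
  zeta.unlock.
by congr (_ *: _); ring.
Qed.

Lemma ebark1 n : ebark n 1 = ebar n.
Proof. by rewrite ebk.unlock eb.unlock /Defs.ebark /= !big_geq // !mulr1. Qed.

Local Notation cup := (@cup N).

Lemma ebarkS n k : ebark n k.+1 = ebar n * (\prod_(2 <= i < k.*2.+2) g n i)
        * (\prod_(1 <= i < k.*2.+1) ginv n i) * ebark n k.
Proof.
under [X in _ * X * _]eq_bigr do rewrite gV.unlock.
by rewrite ebk.unlock eb.unlock /Defs.ebark /Defs.ebar /= -!scalerAl -scalerAr scalerA
  -exprS.
Qed.

(** The letters of e_(k) other than e have index below 2k, so g_i is too far away to meet them in a
    braid relation. *)
Lemma ebark_comm n k i : (k.*2 <= n)%N -> (k.*2 < i < n)%N -> GRing.comm (g n i) (ebark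
  n k).
Proof.
elim: k => [|k IHk] kn ilt; first by rewrite ebk.unlock /Defs.ebark /= scale1r; apply:
  commr1.
have le_k : (k.*2.+2 < i < n)%N by [].
rewrite ebarkS; apply: commrM; last by apply: IHk; lia.
apply: commrM; last first.
  rewrite big_seq; apply: commr_prod => j; rewrite mem_index_iota => jlt.
  by apply/commr_ginv/gg_comm; lia.
apply: commrM; first by apply/commr_sym/ebar_comm; lia.
rewrite big_seq; apply: commr_prod => j; rewrite mem_index_iota => jlt.
by apply: gg_comm; lia.
Qed.

(* The last two letters of both products in the definition of e_(k+2) are
   collected into [cup]; the remaining ones rebuild e_(k+1). *)
Lemma ebark_cup n k : (k.+2.*2 <= n)%N ->
  ebark n k * ebark n k.+1 = ebark n k.+1 ->
  ebark n k.+2 = ebark n k.+1 * cup n k * ebark n k.+1.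
Proof.
move=> kn ek; rewrite [ebark n k.+2]ebarkS.
have cupC : GRing.comm (cup n k) (ebark n k).
  apply: commr_sym; rewrite cup.unlock.
  have ekg i : (k.*2 < i < n)%N -> GRing.comm (ebark n k) (g n i).
    by move=> ilt; apply/commr_sym/ebark_comm => //; lia.
  apply: commrM; last by apply/commr_ginv/ekg; lia.
  apply: commrM; last by apply/commr_ginv/ekg; lia.
  by apply: commrM; apply: ekg; lia.
(* The left factor ebar_(k+1) ends in ebar_(k), which moves past [cup] and is absorbed by the right
   factor. *)
rewrite [X in _ = X * _ * _]ebarkS -(mulrA _ (ebark n k)) -cupC mulrA.
rewrite -(mulrA _ (ebark n k)) ek; congr (_ * _).
rewrite doubleS (@big_nat_recr _ _ _ k.*2.+3 2) //= (@big_nat_recr _ _ _ k.*2.+2 2) //=.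
rewrite (@big_nat_recr _ _ _ k.*2.+2 1) //= (@big_nat_recr _ _ _ k.*2.+1 1) //=.
rewrite cup.unlock !mulrA; congr (_ * _ * _); rewrite -!mulrA; congr (_ * (_ * _)).
(* The two positive letters of [cup] still have to cross the product of the inverses up to index
   2k. *)
have C i : (k.*2.+1 < i < n)%N -> GRing.comm (\prod_(1 <= j < k.*2.+1) ginv n j) (g n i).
  move=> ilt; apply: commr_sym; rewrite big_seq; apply: commr_prod => j.
  by rewrite mem_index_iota => jlt; apply/commr_ginv/gg_comm; lia.
by rewrite mulrA; apply: commr_sym; apply: commrM; apply: C; lia.
Qed.

End BrauerAlgebra.

Section BrauerRelations.
Variables (N : int).
Local Notation g := (@Defs.g N).
Local Notation ginv := (@gV N).
Local Notation ebar := (@eb N).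
Local Notation Br := (@Defs.Br N).
Local Notation ebark := (@ebk N).
Local Notation q := (@Defs.q N).
Local Notation zeta := (@zeta N).

Lemma ebark2 n : (3 < n)%N ->
  ebark n 2 = ebar n * (g n 2 * g n 3 * ginv n 1 * ginv n 2) * ebar n.
Proof.
by move=> n3; rewrite ebarkS ebark1 (@big_ltn _ _ _ 2) // (@big_ltn _ _ _ 3) //
  (@big_geq _ _ _ 4) //
  (@big_ltn _ _ _ 1) // (@big_ltn _ _ _ 2) // (@big_geq _ _ _ 3) // !mulr1 !mulrA.
Qed.

Lemma ebar_conj n i x : (0 < i < n)%N -> i != 2 ->
  ebar n * (ginv n i * x * g n i) * ebar n =
  ginv n i * (ebar n * x * ebar n) * g n i.
Proof.
move=> iN i2; rewrite !mulrA (ebar_commV N iN i2) -!mulrA.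
by rewrite (ebar_comm N iN i2).
Qed.

Lemma ebar_conj_scalar n i x c : (0 < i < n)%N -> i != 2 ->
  ebar n * x * ebar n = c *: ebar n ->
  ebar n * (ginv n i * x * g n i) * ebar n = c *: ebar n.
Proof.
move=> iN i2 xc; rewrite ebar_conj // xc -scalerAr -scalerAl.
by rewrite -mulrA (ebar_comm N iN i2) mul_gVK.
Qed.

Lemma ebar_g2_conj n : (2 < n)%N ->
  ebar n * (g n 2 * g n 1 * ginv n 2) * ebar n = zeta *: ebar n.
Proof.
move=> n2; rewrite conj_g //; apply: ebar_conj_scalar => //; first exact: ltnW.
exact: ebar_g2.
Qed.

(** Writing g_1 = q g_1^-1 + (q - 1) gives the word of e_(2) plus a conjugate of g_2 by g_3, which
    commutes with ebar. *)
Lemma crossing_mixed n : (3 < n)%N ->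
  ebar n * (g n 2 * g n 3 * g n 1 * ginv n 2) * ebar n =
  q *: ebark n 2 + ((q - 1) * zeta) *: ebar n.
Proof.
move=> n3; have n2 := ltnW n3; have n1 := ltnW n2.
have -> : g n 2 * g n 3 * g n 1 * ginv n 2 =
    q *: (g n 2 * g n 3 * ginv n 1 * ginv n 2) + (q - 1) *: (g n 2 * g n 3 * ginv n 2).
  by rewrite [g n 1]gE (mulrDr _ (q *: _)) (mulrDl (_ * (q *: _))) -scalerAr -scalerAl
    mulr_algr -scalerAl.
rewrite mulrDr mulrDl -!scalerAr -!scalerAl -ebark2 //; congr (_ + _).
rewrite -scalerA; congr (_ *: _); rewrite conj_gS //.
by apply: ebar_conj_scalar => //; apply: ebar_g2.
Qed.

(** The left relation on e_(2), multiplied by g_3^-1 g_2^-1. It trades g_3^-1 for a letter of lower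
    index. *)
Lemma ebark2_absl n : (3 < n)%N ->
  ginv n 3 * (ginv n 2 * ebark n 2) = ginv n 1 * (ginv n 2 * ebark n 2).
Proof.
move=> n3; have n2 := ltnW n3; have n1 := ltnW n2.
have e2E : g n 2 * (g n 3 * (ginv n 1 * (ginv n 2 * ebark n 2))) = ebark n 2.
  rewrite ebark2 // eb.unlock gV.unlock /Defs.ebar -!scalerAl -!scalerAr.
  by have /= := @e2_absl N n n3; rewrite -!mulrA => ->.
by rewrite -[in LHS]e2E mul_gVK // mul_gVK.
Qed.

End BrauerRelations.

(** * Subalgebras generated by some of the g_i, and cosets of H_(n-1) *)

(** Words grow on the left only, so an induction removes one letter at a time; products are
    recovered in [gen_mul] and inverses in [gen_gV]. *)
Inductive gen N n (P : pred nat) : Br N n -> Prop :=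
| Gen1 : gen P 1
| GenD x y : gen P x -> gen P y -> gen P (x + y)
| GenZ a x : gen P x -> gen P (a *: x)
| GenM i x : P i -> (0 < i < n)%N -> gen P x -> gen P (g N n i * x).

(** Only sums are taken: the sets [T] used below absorb scalars into one of their factors. *)
Inductive addspan N n (T : Br N n -> Prop) : Br N n -> Prop :=
| SpanT x : T x -> addspan T x
| SpanD x y : addspan T x -> addspan T y -> addspan T (x + y).

Section Generated.
Variables (N : int).
Local Notation g := (@Defs.g N).
Local Notation ginv := (@gV N).
Local Notation ebar := (@eb N).
Local Notation Br := (@Defs.Br N).
Local Notation H := (@Defs.H N).
Local Notation q := (@Defs.q N).
Implicit Types (P : pred nat).

Lemma gen_mul n P (x y : Br n) : gen P x -> gen P y -> gen P (x * y).
Proof.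
move=> Px Py; elim: Px => {x} [|x x' _ IH _ IH'|a x _ IH|i x Pi ilt _ IH].
- by rewrite mul1r.
- by rewrite mulrDl; apply: GenD.
- by rewrite -scalerAl; apply: GenZ.
- by rewrite -mulrA; apply: GenM.
Qed.

Lemma gen_g n P i : P i -> (0 < i < n)%N -> gen P (g n i).
Proof. by move=> Pi ilt; rewrite -[g n i]mulr1; apply/GenM/Gen1. Qed.

Lemma gen_gV n P i : P i -> (0 < i < n)%N -> gen P (ginv n i).
Proof.
move=> Pi ilt; rewrite gVE; apply: GenD; apply: GenZ; first exact: gen_g.
exact: Gen1.
Qed.

Lemma gen_sub n P P' (x : Br n) : (forall i, (0 < i < n)%N -> P i -> P' i) ->
  gen P x -> gen P' x.
Proof.
move=> PP'; elim=> {x} [|x x' _ IH _ IH'|a x _ IH|i x Pi ilt _ IH].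
- exact: Gen1.
- exact: GenD.
- exact: GenZ.
- by apply: GenM => //; apply: PP'.
Qed.

Lemma gen_comm n P (x y : Br n) :
  (forall i, (0 < i < n)%N -> P i -> GRing.comm y (g n i)) -> gen P x -> GRing.comm y x.
Proof.
move=> yP; elim=> {x} [|x x' _ IH _ IH'|a x _ IH|i x Pi ilt _ IH].
- exact: commr1.
- exact: commrD.
- exact: commrZ.
- by apply: commrM => //; apply: yP.
Qed.

Lemma gen_HtoBr n (h : H n) : gen predT (HtoBr N n h).
Proof.
elim/H_ind: h => [|x y Hx Hy|a x Hx|i x ilt Hx].
- by rewrite rmorph1; apply: Gen1.
- by rewrite raddfD; apply: GenD.
- by rewrite linearZ; apply: GenZ.
- by rewrite rmorphM /= HtoBr_g //; apply: GenM.
Qed.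

Lemma incl_gV n i : (0 < i < n)%N -> BrtoBr N n (ginv n i) = ginv n.+1 i.
Proof. by move=> ilt; rewrite !gVE raddfD /= !linearZ /= rmorph1 BrtoBr_g. Qed.

Lemma incl_eb n : (1 < n)%N -> BrtoBr N n (ebar n) = ebar n.+1.
Proof. by move=> n1; rewrite eb.unlock linearZ /= BrtoBr_e. Qed.

Lemma incl_HtoBr n (h : H n) : BrtoBr N n (HtoBr N n h) = HtoBr N n.+1 (HtoH N n h).
Proof.
elim/H_ind: h => [|x y Hx Hy|a x Hx|i x ilt Hx].
- by rewrite !rmorph1.
- by rewrite !raddfD /= Hx Hy.
- by rewrite !linearZ /= Hx.
- have ilt' : (0 < i < n.+1)%N by lia.
  by rewrite !rmorphM /= Hx HtoBr_g // HtoH_g // HtoBr_g // BrtoBr_g.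
Qed.

Lemma incl_gen n P (x : Br n) : gen P x -> gen P (BrtoBr N n x).
Proof.
elim=> {x} [|x x' _ IH _ IH'|a x _ IH|i x Pi ilt _ IH].
- by rewrite rmorph1; apply: Gen1.
- by rewrite raddfD; apply: GenD.
- by rewrite linearZ; apply: GenZ.
- by rewrite rmorphM /= BrtoBr_g //; apply: GenM => //; lia.
Qed.

Lemma gen_restr n P (x : Br n.+1) : (forall i, P i -> (i < n)%N) -> gen P x ->
  exists2 y : Br n, gen P y & x = BrtoBr N n y.
Proof.
move=> Pn; elim=> {x} [|x x' _ [y Py ->] _ [y' Py' ->]|a x _ [y Py ->]|i x Pi ilt _ [y
  Py ->]].
- by exists 1; rewrite ?rmorph1 //; apply: Gen1.
- by exists (y + y'); rewrite ?raddfD //; apply: GenD.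
- by exists (a *: y); rewrite ?linearZ //; apply: GenZ.
- have ilt' : (0 < i < n)%N by have := Pn _ Pi; lia.
  by exists (g n i * y); rewrite ?rmorphM /= ?BrtoBr_g //; apply: GenM.
Qed.

Lemma span_mul n (T T' : Br n -> Prop) (y z x : Br n) :
  addspan T x -> (forall t, T t -> addspan T' (y * t * z)) -> addspan T' (y * x * z).
Proof.
move=> Tx Ty; elim: Tx => {x} [x Tx|x x' _ IHx _ IHy]; first exact: Ty.
by rewrite mulrDr mulrDl; apply: SpanD.
Qed.

Lemma span_mull n (T T' : Br n -> Prop) (y x : Br n) :
  addspan T x -> (forall t, T t -> addspan T' (y * t)) -> addspan T' (y * x).
Proof.
by move=> Tx Ty; rewrite -[_ * x]mulr1; apply: span_mul Tx _ => t; rewrite mulr1;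
  apply: Ty.
Qed.

Lemma span_mulr n (T T' : Br n -> Prop) (y x : Br n) :
  addspan T x -> (forall t, T t -> addspan T' (t * y)) -> addspan T' (x * y).
Proof.
by move=> Tx Ty; rewrite -[x]mul1r; apply: span_mul Tx _ => t; rewrite mul1r; apply: Ty.
Qed.

Lemma span_ind n (T : Br n -> Prop) (Q : Br n -> Prop) x : addspan T x ->
  (forall y z, Q y -> Q z -> Q (y + z)) -> (forall t, T t -> Q t) -> Q x.
Proof. by move=> Tx QD QT; elim: Tx => // *; apply: QD. Qed.

Definition two_sided n P a (x : Br n) :=
  gen P x \/ exists u v, [/\ gen P u, gen P v & x = u * g n a * v].

(** Two letters g_a merge into at most one. If what stands between them commutes with g_a, the
    quadratic relation applies; if it contains one neighbour g_b between factors commuting with g_a,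
    then g_a g_b g_a = g_b g_a g_b does. *)
Lemma two_sided_gen n P a (x : Br n) : (0 < a < n)%N ->
  (forall x, gen P x -> addspan (fun y => [/\ gen P y & GRing.comm (g n a) y] \/
     exists b u v, [/\ (0 < b < n)%N /\ (a = b.+1 \/ b = a.+1),
       gen P (g n b), [/\ gen P u & GRing.comm (g n a) u],
       [/\ gen P v & GRing.comm (g n a) v] & y = u * g n b * v]) x) ->
  gen [pred i | P i || (i == a)] x -> addspan (@two_sided n P a) x.
Proof.
move=> alt Pdec; elim=> {x} [|x x' _ IH _ IH'|c x _ IH|i x Pi ilt _ IH].
- by apply: SpanT; left; apply: Gen1.
- exact: SpanD.
- rewrite -mulr_algl; apply: span_mull IH _ => t Tt; rewrite mulr_algl; apply: SpanT.
  case: Tt => [Pt|[u [v [Pu Pv ->]]]]; [left; exact: GenZ | right].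
  by exists (c *: u), v; split; rewrite -?scalerAl //; apply: GenZ.
case/orP: Pi => [Pi|/eqP ->].
  apply: span_mull IH _ => t [Pt|[u [v [Pu Pv ->]]]]; apply: SpanT.
    by left; apply: GenM.
  by right; exists (g n i * u), v; split; rewrite ?mulrA //; apply: GenM.
apply: span_mull IH _ => t [Pt|[u [v [Pu Pv ->]]]].
  by apply: SpanT; right; exists 1, t; split; rewrite ?mul1r //; apply: Gen1.
have -> : g n a * (u * g n a * v) = g n a * u * (g n a * v) by rewrite !mulrA.
apply: span_mul (Pdec u Pu) _ => s [[Ps sa]|[b [u1 [v1 [[bn ab] Pb [Pu1 u1a] [Pv1 v1a]
  ->]]]]].
  rewrite sa -mulrA [g n a * (_ * _)]mulrA g_quad // mulrDl -scalerAl mulr_algl.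
  rewrite mulrDr; apply: SpanD; apply: SpanT; [right | left].
    by exists ((q - 1) *: s), v; split; rewrite -?scalerAr -?scalerAl ?mulrA //; apply:
      GenZ.
  by rewrite -scalerAr; apply/GenZ/gen_mul.
apply: SpanT; right; exists (u1 * g n b), (g n b * v1 * v); split.
- exact: gen_mul.
- by apply: gen_mul => //; apply: gen_mul.
have aba : g n a * g n b * g n a = g n b * g n a * g n b.
  by case: ab bn alt => -> bn alt; rewrite ?g_braid //; lia.
transitivity (u1 * (g n a * g n b * g n a) * v1 * v).
  by rewrite !mulrA u1a -!mulrA (mulrA v1) -v1a !mulrA.
by rewrite aba !mulrA.
Qed.

(** The decomposition for j is what [two_sided_gen] asks for at j + 1: g_j is the neighbour of
    g_(j+1), and the letters below j commute with it. *)
Lemma two_sided_last n j (x : Br n) : (0 < j < n)%N ->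
  gen [pred i | (i < j.+1)%N] x -> addspan (@two_sided n [pred i | (i < j)%N] j) x.
Proof.
elim: j x => // j IHj x jn Px; apply: two_sided_gen => //; last first.
  by apply: gen_sub Px => i _ /=; rewrite ltnS leq_eqVlt orbC.
move=> y Py; case: (posnP j) => [j0|j0].
  apply: SpanT; left; split=> //; apply: gen_comm Py => i ilt; rewrite inE; lia.
have C z : gen [pred i | (i < j)%N] z -> gen [pred i | (i < j.+1)%N] z /\ GRing.comm (g
  n j.+1) z.
  move=> Pz; split; first by apply: gen_sub Pz => i _ /=; lia.
  by apply: gen_comm Pz => i ilt /= ij; apply: gg_comm; lia.
have jn' : (0 < j < n)%N by lia.
apply: (span_ind (IHj y jn' Py)) => [z t|t [Pt|[u [v [Pu Pv ->]]]]]; first exact: SpanD.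
  by apply: SpanT; left; apply: C.
apply: SpanT; right; exists j, u, v; split=> //; [by split=> //; left | | exact: C |
  exact: C].
by apply: gen_g => //=; lia.
Qed.

(** The mirror image, by descending induction on j. *)
Lemma two_sided_first n m j (x : Br n) : (0 < j < n)%N ->
  gen [pred i | (j <= i < m)%N] x -> addspan (@two_sided n [pred i | (j < i < m)%N] j) x.
Proof.
move: {2}(n - j)%N (erefl (n - j)%N) => d; elim: d j x => [|d IHd] j x nj jn Px; first
  lia.
apply: two_sided_gen => //; last first.
  by apply: gen_sub Px => i _ /=; lia.
move=> y Py; case: (leqP n j.+1) => [j0|j0].
  apply: SpanT; left; split=> //; apply: gen_comm Py => i ilt; rewrite inE; lia.
have C z : gen [pred i | (j.+1 < i < m)%N] z ->
    gen [pred i | (j < i < m)%N] z /\ GRing.comm (g n j) z.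
  move=> Pz; split; first by apply: gen_sub Pz => i _ /=; lia.
  by apply: gen_comm Pz => i ilt /= ij; apply: gg_comm; lia.
case: (leqP m j.+1) => jm.
  apply: SpanT; left; split=> //; apply: gen_comm Py => i ilt; rewrite inE; lia.
have jn' : (0 < j.+1 < n)%N by lia.
have nj' : (n - j.+1)%N = d by lia.
apply: (span_ind (IHd _ y nj' jn' Py)) => [z t|t [Pt|[u [v [Pu Pv ->]]]]]; first exact:
  SpanD.
  by apply: SpanT; left; apply: C.
apply: SpanT; right; exists j.+1, u, v; split=> //; [by split=> //; right | | exact: C
  | exact: C].
by apply: gen_g => //=; lia.
Qed.

End Generated.

(* [ascend n d] is g_2 g_3 ... g_(d+1) and [descendV n d] its inverse, so that
   [eb_last n d] is a cup and a cap, both joining the strands 1 and d + 2. *)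
Fixpoint ascend_rec N n d : Br N n :=
  if d is d'.+1 then ascend_rec N n d' * g N n d'.+2 else 1.

Fixpoint descendV_rec N n d : Br N n :=
  if d is d'.+1 then gV N n d'.+2 * descendV_rec N n d' else 1.

HB.lock Definition ascend N n d := ascend_rec N n d.
HB.lock Definition descendV N n d := descendV_rec N n d.
HB.lock Definition eb_last N n d : Br N n := descendV N n d * eb N n * ascend N n d.

Section Cosets.
Variables (N : int).
Local Notation g := (@Defs.g N).
Local Notation ginv := (@gV N).
Local Notation ebar := (@eb N).
Local Notation Br := (@Defs.Br N).
Local Notation v := (@ascend N).
Local Notation vI := (@descendV N).
Local Notation f := (@eb_last N).
Local Notation q := (@Defs.q N).
Implicit Types (P : pred nat).

Lemma ascend0 n : v n 0 = 1.
Proof. by rewrite ascend.unlock. Qed.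

Lemma ascendS n d : v n d.+1 = v n d * g n d.+2.
Proof. by rewrite ascend.unlock. Qed.

Lemma descendV0 n : vI n 0 = 1.
Proof. by rewrite descendV.unlock. Qed.

Lemma descendVS n d : vI n d.+1 = ginv n d.+2 * vI n d.
Proof. by rewrite descendV.unlock. Qed.

Lemma eb_lastE n d : f n d = vI n d * ebar n * v n d.
Proof. by rewrite eb_last.unlock. Qed.

Lemma ascend_descendV n d : (d.+1 < n)%N -> v n d * vI n d = 1.
Proof.
elim: d => [|d IHd] dn; first by rewrite ascend0 descendV0 mulr1.
by rewrite ascendS descendVS mulrA mulr_gK ?IHd //; lia.
Qed.

Lemma descendV_ascend n d : (d.+1 < n)%N -> vI n d * v n d = 1.
Proof.
elim: d => [|d IHd] dn; first by rewrite ascend0 descendV0 mulr1.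
by rewrite ascendS descendVS -mulrA (mulrA (vI n d)) IHd ?mul1r ?gmulVr //; lia.
Qed.

Lemma gen_ascend n d P : (d.+1 < n)%N -> (forall i, (1 < i < d.+2)%N -> P i) -> gen P
  (v n d).
Proof.
elim: d => [|d IHd] dn Pd; first by rewrite ascend0; apply: Gen1.
by rewrite ascendS; apply: gen_mul; [apply: IHd => [|i id]; [lia | apply: Pd; lia] |
  apply: gen_g; [apply: Pd|]; lia].
Qed.

Lemma gen_descendV n d P : (d.+1 < n)%N -> (forall i, (1 < i < d.+2)%N -> P i) -> gen P
  (vI n d).
Proof.
elim: d => [|d IHd] dn Pd; first by rewrite descendV0; apply: Gen1.
by rewrite descendVS; apply: gen_mul; [apply: gen_gV; [apply: Pd|]; lia | apply: IHd =>
  [|i id]; [lia | apply: Pd; lia]].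
Qed.

(* The generators that commute with e. *)
Definition off2 d : pred nat := [pred i | (i < d)%N && (i != 2)].

(** Double cosets of H_(d+1) and the subalgebra commuting with e. In u g_(d+2) w, the factor w is
    decomposed by induction and its part in the smaller Hecke algebra moves left past g_(d+2). *)
Lemma coset_left n d (a : Br n) : (d.+1 < n)%N -> gen [pred i | (i < d.+2)%N] a ->
  addspan (fun x => exists h k, [/\ gen [pred i | (i < d.+1)%N] h, gen (off2 d.+2) k &
    x = h * k \/ x = h * vI n d * k]) a.
Proof.
elim: d a => [|d IHd] a dn Pa.
  apply: SpanT; exists 1, a; split; [exact: Gen1 | | by left; rewrite mul1r].
  by apply: gen_sub Pa => i ilt; rewrite /off2 /=; lia.
have jn : (0 < d.+2 < n)%N by [].
apply: (span_ind (two_sided_last jn Pa)) => [x y|t [Pt|[u [w [Pu Pw ->]]]]]; first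
  exact: SpanD.
  by apply: SpanT; exists t, 1; split; [exact: Pt | exact: Gen1 | left; rewrite mulr1].
(* With g_(d+2) replaced by its inverse plus a scalar, the first term lengthens [vI] by one letter,
   and in the second [vI n d] is absorbed into the left factor. *)
have split_g h k : gen [pred i | (i < d.+2)%N] h -> gen (off2 d.+3) k ->
    addspan (fun x => exists h k, [/\ gen [pred i | (i < d.+2)%N] h, gen (off2 d.+3) k &
    x = h * k \/ x = h * vI n d.+1 * k]) (h * g n d.+2 * vI n d * k).
  move=> Ph Pk; rewrite gE mulrDr !mulrDl; apply: SpanD; apply: SpanT.
    exists (q *: h), k; split=> //; first exact: GenZ.
    by right; rewrite descendVS -scalerAr -!scalerAl !mulrA.
  exists ((q - 1) *: (h * vI n d)), k; split=> //; last first.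
    by left; rewrite -scalerAr mulr1 -!scalerAl.
  by apply/GenZ/gen_mul => //; apply: gen_descendV => [|i]; rewrite /=; lia.
have off2S k : gen (off2 d.+2) k -> gen (off2 d.+3) k.
  by apply: gen_sub => i _; rewrite /off2 /=; lia.
case: d => [|d] in IHd dn Pa jn u w Pu Pw split_g off2S *.
  rewrite -[u * _]mulr1 -(descendV0 n); apply: split_g => //.
  by apply: gen_sub Pw => i ilt; rewrite /off2 /=; lia.
apply: span_mull (IHd w _ Pw) _ => [|x [h [k [Ph Pk xE]]]]; first lia.
have gh : GRing.comm (g n d.+3) h.
  by apply: gen_comm Ph => i ilt; rewrite inE => il; apply: gg_comm; lia.
have Puh : gen [pred i | (i < d.+3)%N] (u * h).
  by apply: gen_mul => //; apply: gen_sub Ph => i _ /=; lia.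
case: xE => ->.
  apply: SpanT; exists (u * h), (g n d.+3 * k); split=> //; last first.
    by left; rewrite -mulrA (mulrA _ h) gh !mulrA.
  by apply: GenM => //; [rewrite /off2 /=; lia | apply: off2S].
rewrite mulrA mulrA -(mulrA u) gh mulrA; apply: split_g => //; exact: off2S.
Qed.

(** The mirror image; as [v] is a word in the g_i themselves, no inverse has to be introduced. *)
Lemma coset_right n d (a : Br n) : (d.+1 < n)%N -> gen [pred i | (i < d.+2)%N] a ->
  addspan (fun x => exists h k, [/\ gen [pred i | (i < d.+1)%N] h, gen (off2 d.+2) k &
    x = k * h \/ x = k * v n d * h]) a.
Proof.
elim: d a => [|d IHd] a dn Pa.
  apply: SpanT; exists 1, a; split; [exact: Gen1 | | by left; rewrite mulr1].
  by apply: gen_sub Pa => i ilt; rewrite /off2 /=; lia.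
have jn : (0 < d.+2 < n)%N by [].
apply: (span_ind (two_sided_last jn Pa)) => [x y|t [Pt|[u [w [Pu Pw ->]]]]]; first
  exact: SpanD.
  by apply: SpanT; exists t, 1; split; [exact: Pt | exact: Gen1 | left; rewrite mul1r].
have off2S k : gen (off2 d.+2) k -> gen (off2 d.+3) k.
  by apply: gen_sub => i _; rewrite /off2 /=; lia.
case: d => [|d] in IHd dn Pa jn u w Pu Pw off2S *.
  apply: SpanT; exists w, u; split=> //; last by right; rewrite ascendS ascend0 mul1r.
  by apply: gen_sub Pu => i ilt; rewrite /off2 /=; lia.
rewrite -[u * _ * w]mulrA; apply: span_mulr (IHd u _ Pu) _ => [|x [h [k [Ph Pk xE]]]];
  first lia.
have gh : GRing.comm (g n d.+3) h.
  by apply: gen_comm Ph => i ilt; rewrite inE => il; apply: gg_comm; lia.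
have Phw : gen [pred i | (i < d.+3)%N] (h * w).
  by apply: gen_mul => //; apply: gen_sub Ph => i _ /=; lia.
case: xE => ->.
  apply: SpanT; exists (h * w), (k * g n d.+3); split=> //; last first.
    by left; rewrite !mulrA -(mulrA k h) -gh !mulrA.
  by apply: gen_mul; [apply: off2S | apply: gen_g => //; rewrite /off2 /=; lia].
apply: SpanT; exists (h * w), k; split=> //; first exact: off2S.
by right; rewrite (ascendS n d.+1) !mulrA -(mulrA _ h) -gh !mulrA.
Qed.

(** The last letter of [v] commutes with g_i unless i = d + 1; in that case the braid relation on
    the last two letters produces g_(d+2), which passes the rest of [v]. *)
Lemma ascend_shift n d i : (d.+1 < n)%N -> (1 < i < d.+1)%N ->
  v n d * g n i = g n i.+1 * v n d.
Proof.
elim: d => [|d IHd] dn id; first lia.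
case: (ltnP i d.+1) => [lt_id|le_di].
  rewrite ascendS -mulrA (@gg_comm N n d.+2 i) ?mulrA; try lia.
  by rewrite IHd //; lia.
have ->: i = d.+1 by lia.
case: d => [|d] in IHd dn id le_di *; first lia.
rewrite !ascendS -!mulrA (mulrA (g n d.+2)) g_braid ?mulrA; try lia.
rewrite -!mulrA !(mulrA (v n d)).
suff -> : v n d * g n d.+3 = g n d.+3 * v n d by rewrite !mulrA.
apply: commr_sym; apply: (gen_comm (P := [pred i | (i < d.+2)%N])).
  by move=> j jn; rewrite inE => jd; apply: gg_comm; lia.
by apply: gen_ascend => [|j]; rewrite ?inE; lia.
Qed.

Lemma descendV_shift n d i : (d.+1 < n)%N -> (1 < i < d.+1)%N ->
  vI n d * g n i.+1 = g n i * vI n d.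
Proof.
move=> dn id; rewrite -[g n i.+1]mulr1 -(ascend_descendV dn) (mulrA (g n _) (v n d)).
by rewrite -ascend_shift // !mulrA descendV_ascend // mul1r.
Qed.

(** Passing [v] turns g_i into g_(i+1), whose index exceeds 2, so that it commutes with ebar;
    passing [vI] turns it back. *)
Lemma eb_last_comm n d (u : Br n) : (d.+1 < n)%N -> gen [pred i | (1 < i < d.+1)%N] u ->
  GRing.comm (f n d) u.
Proof.
move=> dn; apply: gen_comm => i ilt; rewrite inE => id; rewrite !eb_lastE /GRing.comm.
rewrite -mulrA ascend_shift // !mulrA -descendV_shift // -(mulrA (vI n d)) ebar_comm
  ?mulrA //; lia.
Qed.

Lemma eb_lastS n d : f n d.+1 = ginv n d.+2 * f n d * g n d.+2.
Proof. by rewrite !eb_lastE ascendS descendVS !mulrA. Qed.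

End Cosets.

(** * The corner of ebar *)

Section Corner.
Variables (N : int).
Hypothesis hN : N != 0.
Variable Psi : forall k m : nat, Br N (m + k.*2) -> Br N m.
Hypothesis hPsi : forall k m : nat, is_Psi (@Psi k m).
Local Notation g := (@Defs.g N).
Local Notation ginv := (@gV N).
Local Notation ebar := (@eb N).
Local Notation ebark := (@ebk N).
Local Notation Br := (@Defs.Br N).
Local Notation cup := (@cup N).

(* [Psi k m] with the index written so that [1.*2 + m] computes to [m.+2]. *)
Definition psi_of k m (x : Br (k.*2 + m)) : Br m :=
  @Psi k m (eq_rect_r (Defs.Br N) x (addnC m k.*2)).

Record psi_spec k m n (ps : Br n -> Br m) : Prop := PsiSpec {
  psiZD : forall a x y, corner (ebark n k) x -> corner (ebark n k) y ->
    ps (a *: x + y) = a *: ps x + ps y;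
  psiM : forall x y, corner (ebark n k) x -> corner (ebark n k) y ->
    ps (x * y) = ps x * ps y;
  psi1 : ps (ebark n k) = 1;
  psi_inj : forall x y, corner (ebark n k) x -> corner (ebark n k) y ->
    ps x = ps y -> x = y;
  psi_surj : forall z, exists2 x, corner (ebark n k) x & ps x = z;
  psi_g : forall i, (0 < i < m)%N -> ps (ebark n k * g n (i + k.*2)) = g m i;
  psi_eb : (1 < m)%N -> ps (ebark n k.+1) = ebar m }.

Lemma psiP k m : psi_spec k (@psi_of k m).
Proof.
rewrite /psi_of; move: (addnC m k.*2); move: (k.*2 + m)%N => n E; case: _ / E.
rewrite /eq_rect_r /=; case: (hPsi k m) => ZD M one inj surj Pg Pe.
split; rewrite ?ebk.unlock ?eb.unlock //.
by move=> i im; rewrite Pg ?addnK //; lia.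
Qed.

Fact theta_ex m (y : Br m) : exists2 x : Br m.+2, corner (ebar m.+2) x & psi_of (k :=
  1) x = y.
Proof. by have := psi_surj (psiP 1 m) y; rewrite ebark1. Qed.

Definition theta m (y : Br m) : Br m.+2 := projT1 (cid2 (theta_ex y)).

(** Compressing by ebar first gives a total map; it inverts [theta] on the corner. *)
Definition theta_inv m (x : Br m.+2) : Br m := psi_of (k := 1) (ebar m.+2 * x * ebar
  m.+2).

Let ebarI m : ebar m.+2 * ebar m.+2 = ebar m.+2.
Proof. exact: ebar_idem. Qed.

Lemma cornerP m (x : Br m.+2) : corner (ebar m.+2) x <-> ebar m.+2 * x * ebar m.+2 = x.
Proof.
split=> [[y ->]|xE]; last by exists x.
by rewrite !mulrA ebarI -!mulrA ebarI.
Qed.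

Lemma theta_corner m (y : Br m) : corner (ebar m.+2) (theta y).
Proof. by rewrite /theta; case: cid2. Qed.

Lemma psi_theta m (y : Br m) : psi_of (k := 1) (theta y) = y.
Proof. by rewrite /theta; case: cid2. Qed.

Lemma ebar_theta m (y : Br m) : ebar m.+2 * theta y = theta y.
Proof. by have /cornerP <- := theta_corner y; rewrite !mulrA ebarI. Qed.

Lemma theta_ebar m (y : Br m) : theta y * ebar m.+2 = theta y.
Proof. by have /cornerP <- := theta_corner y; rewrite -!mulrA ebarI. Qed.

Lemma corner_inj m (x y : Br m.+2) : corner (ebar m.+2) x -> corner (ebar m.+2) y ->
  psi_of (k := 1) x = psi_of (k := 1) y -> x = y.
Proof. by have := @psi_inj _ _ _ _ (psiP 1 m) x y; rewrite ebark1. Qed.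

Lemma theta_psi m (x : Br m.+2) : corner (ebar m.+2) x -> theta (psi_of (k := 1) x) = x.
Proof.
by move=> Cx; apply: corner_inj => //; [apply: theta_corner | apply: psi_theta].
Qed.

Lemma thetaK m : cancel (@theta m) (@theta_inv m).
Proof. by move=> y; rewrite /theta_inv ebar_theta theta_ebar psi_theta. Qed.

Lemma theta_invK m (x : Br m.+2) : theta (theta_inv x) = ebar m.+2 * x * ebar m.+2.
Proof. by rewrite theta_psi //; exists x. Qed.

Lemma theta_inj m : injective (@theta m).
Proof. exact: can_inj (@thetaK m). Qed.

Lemma corner_lin m a (x y : Br m.+2) : corner (ebar m.+2) x -> corner (ebar m.+2) y ->
  corner (ebar m.+2) (a *: x + y).
Proof.
move=> /cornerP xE /cornerP yE; apply/cornerP.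
by rewrite mulrDr mulrDl -scalerAr -scalerAl xE yE.
Qed.

Fact theta_linear m : linear (@theta m).
Proof.
move=> a x y; apply: corner_inj.
- exact: theta_corner.
- by apply: corner_lin; apply: theta_corner.
rewrite psi_theta; have := @psiZD _ _ _ _ (psiP 1 m) a (theta x) (theta y).
by rewrite ebark1 !psi_theta => -> //; apply: theta_corner.
Qed.

HB.instance Definition _ m :=
  GRing.isLinear.Build (ground N) (Br m) (Br m.+2) *:%R (@theta m) (@theta_linear m).

Lemma thetaM m (x y : Br m) : theta (x * y) = theta x * theta y.
Proof.
apply: corner_inj.
- exact: theta_corner.
- apply/cornerP.
  by rewrite mulrA ebar_theta -mulrA theta_ebar.
rewrite psi_theta; have := @psiM _ _ _ _ (psiP 1 m) (theta x) (theta y).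
by rewrite ebark1 !psi_theta => -> //; apply: theta_corner.
Qed.

Lemma theta1 m : theta (1 : Br m) = ebar m.+2.
Proof.
apply: corner_inj; first exact: theta_corner.
  by apply/cornerP; rewrite !ebarI.
by rewrite psi_theta; have := psi1 (psiP 1 m); rewrite ebark1.
Qed.

Lemma theta_g m i : (0 < i < m)%N -> theta (g m i) = ebar m.+2 * g m.+2 i.+2.
Proof.
move=> im; apply: corner_inj; first exact: theta_corner.
  apply/cornerP; rewrite mulrA ebarI -mulrA -(@ebar_comm N m.+2 i.+2) ?mulrA ?ebarI //;
    lia.
by rewrite psi_theta; have := psi_g (psiP 1 m) im; rewrite ebark1 addn2.
Qed.

Lemma theta_gV m i : (0 < i < m)%N -> theta (ginv m i) = ebar m.+2 * ginv m.+2 i.+2.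
Proof.
move=> im; rewrite !gVE linearD !linearZ /= theta_g // theta1.
by rewrite mulrDr -!scalerAr mulr1.
Qed.

Lemma theta_eb m : (1 < m)%N -> theta (ebar m) = ebark m.+2 2.
Proof.
move=> m1; apply: corner_inj; first exact: theta_corner.
  apply/cornerP; rewrite ebark2 //.
  by rewrite !mulrA ebarI -!mulrA ebarI.
by rewrite psi_theta; have := psi_eb (psiP 1 m) m1.
Qed.

Lemma theta_cup m l : (l.*2.+3 < m)%N -> theta (cup m l) = ebar m.+2 * cup m.+2 l.+1.
Proof.
move=> lm; rewrite !cup.unlock !thetaM !theta_g ?theta_gV; try lia.
have C i : (2 < i < m.+2)%N -> GRing.comm (ebar m.+2) (g m.+2 i).
  by move=> im; apply: ebar_comm; lia.
have CV i : (2 < i < m.+2)%N -> GRing.comm (ebar m.+2) (ginv m.+2 i).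
  by move=> im; apply: ebar_commV; lia.
have push x y : GRing.comm (ebar m.+2) x ->
    ebar m.+2 * x * (ebar m.+2 * y) = ebar m.+2 * (x * y).
  by move=> xC; rewrite mulrA -(mulrA _ x) -xC !mulrA ebarI.
rewrite !push ?mulrA //.
all: by do ?[apply: C; lia | apply: CV; lia | apply: commrM].
Qed.

End Corner.

(** * Iterates of theta and the corners of ebar_(k) *)

Section IteratedCorner.
Variables (N : int).
Hypothesis hN : N != 0.
Variable Psi : forall k m : nat, Br N (m + k.*2) -> Br N m.
Hypothesis hPsi : forall k m : nat, is_Psi (@Psi k m).
Local Notation g := (@Defs.g N).
Local Notation ebar := (@eb N).
Local Notation ebark := (@ebk N).
Local Notation Br := (@Defs.Br N).
Local Notation H := (@Defs.H N).
Local Notation Hg := (@Defs.Hg N).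
Local Notation theta := (@theta N hN Psi hPsi).
Local Notation theta_inv := (@theta_inv N Psi).
Local Notation psi k m := (@psi_of N Psi k m).

Lemma ebark0 n : ebark n 0 = 1.
Proof. by rewrite ebk.unlock /Defs.ebark /= scale1r. Qed.

(** The three claims need a joint induction: the absorption rule for l + 1 is the image under
    [theta] of the one for l, and it is the hypothesis of [ebark_cup] in the next step. *)
Lemma theta_ebark_aux l :
  [/\ forall m, (l.*2 <= m)%N -> theta (ebark m l) = ebark m.+2 l.+1,
      forall m, (l.+1.*2 <= m)%N -> theta (ebark m l.+1) = ebark m.+2 l.+2 &
      forall m, (l.+1.*2 <= m)%N -> ebark m l * ebark m l.+1 = ebark m l.+1].
Proof.
elim: l => [|l [A A1 B]].
  split=> m lm; first by rewrite ebark0 theta1 ebark1.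
    by rewrite ebark1 theta_eb.
  by rewrite ebark0 mul1r.
have B1 m : (l.+2.*2 <= m)%N -> ebark m l.+1 * ebark m l.+2 = ebark m l.+2.
  case: m => [|[|m]] // lm; rewrite -A -?A1 -?thetaM ?B //; lia.
split=> // m lm.
rewrite ebark_cup // ?B ?thetaM ?theta_cup ?A1 //; try lia.
rewrite [RHS]ebark_cup ?B1 //; last lia.
rewrite (mulrA (ebark _ _)) -A1; last lia.
by rewrite theta_ebar.
Qed.

Lemma theta_ebark l m : (l.*2 <= m)%N -> theta (ebark m l) = ebark m.+2 l.+1.
Proof. by case: (theta_ebark_aux l) => + _ _; apply. Qed.

Lemma ebark_idem n l : (l.*2 <= n)%N -> ebark n l * ebark n l = ebark n l.
Proof.
elim: l n => [|l IHl] n ln; first by rewrite ebark0 mul1r.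
case: n ln => [|[|n]] // ln; rewrite -theta_ebark -?thetaM ?IHl //; lia.
Qed.

(** [h'] is [h] with all indices raised by 2. Its letters commute with ebar, hence the same [h']
    serves on both sides. *)
Lemma theta_HtoBr m (h : H m) : exists h' : H m.+2, forall y,
  theta (HtoBr N m h * y) = HtoBr N m.+2 h' * theta y /\
  theta (y * HtoBr N m h) = theta y * HtoBr N m.+2 h'.
Proof.
elim/H_ind: h => [|x y [x' Hx] [y' Hy]|a x [x' Hx]|i x im [x' Hx]].
- by exists 1 => y; rewrite !rmorph1 !mul1r !mulr1.
- exists (x' + y') => z; rewrite !raddfD /= !mulrDl !mulrDr !raddfD /=.
  by have [-> ->] := Hx z; have [-> ->] := Hy z.
- exists (a *: x') => z; rewrite !linearZ /= -!scalerAl -!scalerAr !linearZ /=.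
  by have [-> ->] := Hx z.
- have im' : (0 < i.+2 < m.+2)%N by lia.
  exists (Hg m.+2 i.+2 * x') => z; rewrite !rmorphM /= !HtoBr_g //.
  have gC : ebar m.+2 * g m.+2 i.+2 = g m.+2 i.+2 * ebar m.+2.
    by apply: ebar_comm => //; lia.
  split; first rewrite -mulrA thetaM theta_g // gC -mulrA ebar_theta.
    by have [-> _] := Hx z; rewrite mulrA.
  rewrite mulrA; have [_ ->] := Hx (z * g m i).
  by rewrite thetaM theta_g // mulrA theta_ebar mulrA.
Qed.

Fixpoint thetak k m (y : Br m) : Br (k.*2 + m) :=
  if k is k'.+1 then theta (thetak k' y) else y.

Lemma thetak_linear k m : linear (@thetak k m).
Proof. by elim: k => // k IHk a x y /=; rewrite IHk linearP. Qed.

Lemma thetak0 k m : thetak k (0 : Br m) = 0.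
Proof. by elim: k => //= k ->; rewrite linear0. Qed.

Lemma thetakM k m (x y : Br m) : thetak k (x * y) = thetak k x * thetak k y.
Proof. by elim: k => //= k IHk; rewrite IHk thetaM. Qed.

Lemma thetak1 k m : thetak k (1 : Br m) = ebark (k.*2 + m) k.
Proof.
elim: k => [|k IHk] /=; first by rewrite ebark0.
by rewrite IHk theta_ebark // leq_addr.
Qed.

Lemma thetak_g k m i : (0 < i < m)%N ->
  thetak k (g m i) = ebark (k.*2 + m) k * g (k.*2 + m) (i + k.*2).
Proof.
move=> im; elim: k => [|k IHk] /=; first by rewrite ebark0 mul1r addn0.
rewrite IHk thetaM theta_ebark ?leq_addr // theta_g; last lia.
rewrite mulrA -{1}theta_ebark ?leq_addr // theta_ebar theta_ebark ?leq_addr //.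
by have -> : (i + k.*2).+2 = (i + k.+1.*2)%N by lia.
Qed.

Lemma thetak_eb k m : (1 < m)%N -> thetak k (ebar m) = ebark (k.*2 + m) k.+1.
Proof.
move=> m1; elim: k => [|k IHk] /=; first by rewrite ebark1.
by rewrite IHk theta_ebark //; lia.
Qed.

Lemma thetak_corner k m (y : Br m) : corner (ebark (k.*2 + m) k) (thetak k y).
Proof.
exists (thetak k y); rewrite -thetak1 -!thetakM mul1r mulr1 //.
Qed.

(** This identifies Psi_k with k applications of Psi_1: Psi_k composed with [thetak] is
    multiplicative and linear and fixes the generators. *)
Lemma psi_thetak k m (y : Br m) : psi k m (thetak k y) = y.
Proof.
have ZD := psiZD (psiP hN hPsi k m); have M := psiM (psiP hN hPsi k m).
have lin a x z : psi k m (thetak k x) = x -> psi k m (thetak k z) = z ->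
    psi k m (thetak k (a *: x + z)) = a *: x + z.
  by move=> xE zE; rewrite thetak_linear ZD ?xE ?zE //; apply: thetak_corner.
have mul x z : psi k m (thetak k x) = x -> psi k m (thetak k z) = z ->
    psi k m (thetak k (x * z)) = x * z.
  by move=> xE zE; rewrite thetakM M ?xE ?zE //; apply: thetak_corner.
(* Linearity is known only in the form a x + y on the corner; the value at 0 comes from (-1) 0 +
   0. *)
have zero : psi k m (thetak k 0) = 0.
  have C0 := thetak_corner k (0 : Br m); rewrite thetak0 in C0 *.
  by have := ZD (-1) _ _ C0 C0; rewrite !scaleN1r !addNr.
elim/Br_ind: y => [|x z Qx Qz|a x Qx|i x im Qx|m1 x Qx].
- by rewrite thetak1; apply: psi1 (psiP hN hPsi k m).
- by rewrite -[x]scale1r; apply: lin.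
- by rewrite -[a *: x]addr0; apply: lin.
- by apply: mul => //; rewrite thetak_g //; apply: psi_g (psiP hN hPsi k m) _ _.
- rewrite e_ebar // -scalerAl -[_ *: _]addr0; apply: lin => //; apply: mul => //.
  by rewrite thetak_eb //; apply: psi_eb (psiP hN hPsi k m) _.
Qed.

Lemma thetak_ex k m (x : Br (k.*2 + m)) :
  exists y : Br m, ebark (k.*2 + m) k * x * ebark (k.*2 + m) k = thetak k y.
Proof.
elim: k x => [|k IHk] x; first by exists x; rewrite ebark0 mul1r mulr1.
have [y yE] := IHk (theta_inv x); exists y.
have -> : ebark (k.+1.*2 + m) k.+1 = theta (ebark (k.*2 + m) k).
  by rewrite theta_ebark // leq_addr.
rewrite /= -yE !thetaM theta_invK !mulrA theta_ebar -!mulrA.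
by rewrite ebar_theta.
Qed.

End IteratedCorner.

(** * Trace property *)

Section Trace.
Variables (N : int).
Hypothesis hN : N != 0.
Variable Psi : forall k m : nat, Br N (m + k.*2) -> Br N m.
Hypothesis hPsi : forall k m : nat, is_Psi (@Psi k m).
Variable tr : forall n : nat, {scalar Br N n}.
Hypothesis htr : is_tr Psi tr.
Local Notation ebar := (@eb N).
Local Notation ebark := (@ebk N).
Local Notation Br := (@Defs.Br N).
Local Notation H := (@Defs.H N).
Local Notation Hg := (@Defs.Hg N).
Local Notation theta := (@theta N hN Psi hPsi).
Local Notation theta_inv := (@theta_inv N Psi).
Local Notation thetak := (@thetak N hN Psi hPsi).
Local Notation psi k m := (@psi_of N Psi k m).
Local Notation kappa := (@kappa N).

(** The span is a left ideal containing 1: ebar a theta(y) = (ebar a ebar) theta(y), which lies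
    again in the image of [theta]. *)
Lemma Br_span_theta m (Q : Br m.+2 -> Prop) :
  (forall x y, Q x -> Q y -> Q (x + y)) -> (forall h, Q (HtoBr N _ h)) ->
  (forall a y b, Q (HtoBr N _ a * theta y * HtoBr N _ b)) -> forall x, Q x.
Proof.
move=> QD QH Qt x.
pose T (x : Br m.+2) := (exists h, x = HtoBr N _ h) \/
  exists a y b, x = HtoBr N _ a * theta y * HtoBr N _ b.
suff : addspan T x by move=> /span_ind; apply=> // t [[h ->]|[a [y [b ->]]]].
have Tmul h y : addspan T y -> addspan T (HtoBr N _ h * y).
  move=> Ty; apply: span_mull Ty _ => t [[h' ->]|[a [y' [b ->]]]]; apply: SpanT.
    by left; exists (h * h'); rewrite rmorphM.
  by right; exists (h * a), y', b; rewrite rmorphM !mulrA.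
elim/Br_ind: x => [|x y Tx Ty|a x Tx|i x im Tx|_ x Tx].
- by apply: SpanT; left; exists 1; rewrite rmorph1.
- exact: SpanD.
- by have := Tmul a%:A _ Tx; rewrite linearZ /= rmorph1 mulr_algl.
- by have := Tmul (Hg _ i) _ Tx; rewrite HtoBr_g.
have := Tmul qnum%:A _ Tx; rewrite linearZ /= rmorph1 mulr_algl.
rewrite e_ebar // -scalerAl scalerAr; move: (qnum *: x) => {}x {}Tx.
apply: span_mull Tx _ => t [[h ->]|[a [y [b ->]]]]; apply: SpanT; right.
  by exists 1, 1, h; rewrite rmorph1 mul1r theta1.
exists 1, (theta_inv (HtoBr N _ a) * y), b; rewrite rmorph1 mul1r thetaM theta_invK.
by rewrite -[_ * ebar _ * theta y]mulrA ebar_theta !mulrA.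
Qed.

Lemma Br_small n : (n < 2)%N -> forall x : Br n, exists h, x = HtoBr N n h.
Proof.
move=> n2; elim/Br_ind=> [|x y [h ->] [k ->]|a x [h ->]|i x im [h ->]|n1].
- by exists 1; rewrite rmorph1.
- by exists (h + k); rewrite raddfD.
- by exists (a *: h); rewrite linearZ.
- by exists (Hg n i * h); rewrite rmorphM /= HtoBr_g.
- by rewrite ltnNge n1 in n2.
Qed.

(** By induction in steps of two, since theta(a ebar_(k) b) is h ebar_(k+1) h' for shifted h and
    h'. *)
Lemma Br_span n (Q : Br n -> Prop) :
  (forall x y, Q x -> Q y -> Q (x + y)) -> (forall h, Q (HtoBr N _ h)) ->
  (forall k a b, (0 < k)%N -> (k.*2 <= n)%N ->
     Q (HtoBr N _ a * ebark n k * HtoBr N _ b)) -> forall x, Q x.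
Proof.
elim/ltn_ind: n Q => n IHn Q QD QH Qk.
case: (ltnP n 2) => [n2 x|]; first by have [h ->] := Br_small n2 x.
case: n => [|[|m]] // in IHn Q QD QH Qk * => _.
apply: Br_span_theta => // a y b; move: y a b; apply: (IHn m) => //.
- by move=> x y Qx Qy a b; rewrite raddfD mulrDr mulrDl; apply: QD.
- move=> h a b; have [h' Hh'] := theta_HtoBr hN hPsi h.
  have [+ _] := Hh' 1; rewrite mulr1 => ->.
  by rewrite theta1 -ebark1 mulrA -rmorphM; apply: Qk.
move=> k a b k0 km a' b'; have [h Hh] := theta_HtoBr hN hPsi a.
have [h' Hh'] := theta_HtoBr hN hPsi b.
rewrite (Hh' _).2 (Hh _).1 theta_ebark // !mulrA -rmorphM -mulrA -rmorphM.
by apply: Qk.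
Qed.

Lemma tr_psi k m (a b : H (k.*2 + m)) : (0 < k)%N ->
  tr _ (HtoBr N _ a * ebark _ k * HtoBr N _ b) = kappa ^+ k *
    tr m (psi k m (ebark _ k * (HtoBr N _ b * HtoBr N _ a) * ebark _ k)).
Proof.
move=> k0; rewrite /psi_of ebk.unlock kappa.unlock; move: a b; move: (addnC m k.*2).
by move: (k.*2 + m)%N => n E; case: _ / E => a b; apply: tr_ebark htr k m a b k0.
Qed.

Lemma tr_thetak k m (a b : H (k.*2 + m)) (y : Br m) : (0 < k)%N ->
  thetak k y = ebark _ k * (HtoBr N _ b * HtoBr N _ a) * ebark _ k ->
  tr _ (HtoBr N _ a * ebark _ k * HtoBr N _ b) = kappa ^+ k * tr m y.
Proof. by move=> k0 yE; rewrite tr_psi // -yE psi_thetak. Qed.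

Lemma theta_inv1 m : theta_inv (1 : Br m.+2) = 1.
Proof. by apply: (@theta_inj N hN Psi hPsi m); rewrite theta_invK mulr1 ebar_idem //
  theta1. Qed.

(** Both properties are carried through one strong induction: the sandwich formula at n uses the
    trace property at n - 2, and the trace property at n uses the sandwich formula at n. *)
Let trace_on n := (forall x y : Br n, tr n (x * y) = tr n (y * x)) /\
  match n return Prop with
  | m.+2 => forall a (y : Br m) b, tr _ (HtoBr N _ a * theta y * HtoBr N _ b) =
       kappa * tr m (y * theta_inv (HtoBr N _ b * HtoBr N _ a))
  | _ => True
  end.

Lemma tr_thetak_of l m n (y : Br m) : (forall j, (j < n)%N -> trace_on j) ->
  (l.*2 + m < n)%N -> tr _ (thetak l y) = kappa ^+ l * tr m y.
Proof.
move=> IH; elim: l => [|l IHl] ln /=; first by rewrite expr0 mul1r.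
have [_ /(_ 1 (thetak l y) 1)] := IH _ ln.
rewrite rmorph1 !mul1r !mulr1 theta_inv1 mulr1 => ->.
by rewrite IHl ?exprS ?mulrA //; lia.
Qed.

(** For y = a' ebar_(l) b' the left argument has the form a'' ebar_(l+1) b'', so the definition of
    [tr] gives kappa^(l+1). On the right, the same element of the corner comes from l applications
    of [theta], which give kappa^l. *)
Lemma tr_sandwich_of m : (forall j, (j < m.+2)%N -> trace_on j) ->
  forall (y : Br m) a b, tr _ (HtoBr N _ a * theta y * HtoBr N _ b) =
       kappa * tr m (y * theta_inv (HtoBr N _ b * HtoBr N _ a)).
Proof.
move=> IH; have [trC _] := IH m (ltnW (ltnSn _)).
apply: Br_span => [x y Qx Qy a b|h a b|l a' b' l0 lm a b].
- by rewrite raddfD mulrDr !mulrDl !raddfD /= Qx Qy mulrDr.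
- have [h' Hh'] := theta_HtoBr hN hPsi h.
  have hE : theta (HtoBr N _ h) = HtoBr N _ h' * ebar _.
    by have [+ _] := Hh' 1; rewrite mulr1 theta1.
  have hE' : theta (HtoBr N _ h) = ebar _ * HtoBr N _ h'.
    by have [_ +] := Hh' 1; rewrite mul1r theta1.
  rewrite hE mulrA -rmorphM -ebark1 /=.
  rewrite (@tr_thetak 1 m _ _ (theta_inv (HtoBr N _ b * HtoBr N _ a) * HtoBr N _ h)) //.
    by rewrite expr1 trC.
  rewrite /= (Hh' _).2 theta_invK ebark1 rmorphM /= !mulrA.
  by rewrite -mulrA -hE' hE !mulrA.
have [m0 mE] : exists m0, m = (l.*2 + m0)%N by exists (m - l.*2)%N; lia.
subst m; have [h Hh] := theta_HtoBr hN hPsi a'; have [h' Hh'] := theta_HtoBr hN hPsi b'.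
set X := HtoBr N _ b * HtoBr N _ a; set el := ebark _ l.
(* This [y] is the common compression to which both sides reduce. *)
have [y yE] := thetak_ex hN hPsi (HtoBr N _ b' * theta_inv X * HtoBr N _ a').
have idl : el * el = el by apply: ebark_idem.
have e1E : ebark (l.*2 + m0).+2 l.+1 = theta el by rewrite theta_ebark.
have absr : theta el * HtoBr N _ h' * ebar _ = theta el * HtoBr N _ h'.
  by rewrite -(Hh' el).2 theta_ebar.
have absl : ebar _ * (HtoBr N _ h * theta el) = HtoBr N _ h * theta el.
  by rewrite -(Hh el).1 ebar_theta.
have yE' : theta (thetak l y) =
    theta el * (HtoBr N _ (h' * b) * HtoBr N _ (a * h)) * theta el.
  transitivity (theta (el * HtoBr N _ b') * theta (theta_inv X) * theta (HtoBr N _ a' *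
    el)).
    by rewrite -!thetaM -yE !mulrA.
  rewrite (Hh' _).2 (Hh _).1 theta_invK !mulrA absr -!mulrA absl.
  by rewrite /X !rmorphM /= !mulrA.
rewrite (Hh' _).2 (Hh _).1 -e1E !mulrA -rmorphM -mulrA -rmorphM.
rewrite (@tr_thetak l.+1 m0 _ _ y) ?e1E // exprS -mulrA.
rewrite -(tr_thetak_of (n := (l.*2 + m0).+2)) //.
rewrite -yE trC mulrA idl trC.
by rewrite [in RHS]trC -!mulrA trC !mulrA.
Qed.

(** Only commutation with H and with ebar has to be checked, as they generate. The sandwich formula
    settles H directly and reduces ebar to the trace property two levels down. *)
Lemma trace_onP n : trace_on n.
Proof.
elim/ltn_ind: n => n IH; case: (ltnP n 2) => [n2|].
  split; last by case: n n2 {IH} => [|[|]].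
  move=> x y; have [h ->] := Br_small n2 x; have [k ->] := Br_small n2 y.
  by rewrite -!rmorphM; apply: MarkovC (tr_Markov htr) _ _ _.
case: n IH => [|[|m]] // IH _; have tau := tr_sandwich_of IH.
split; last by move=> a y b; apply: tau.
have [trC _] := IH m (ltnW (ltnSn _)).
have HC h x : tr _ (HtoBr N m.+2 h * x) = tr _ (x * HtoBr N _ h).
  move: x; apply: Br_span_theta => [x y Hx Hy|k|a y b].
  - by rewrite mulrDl mulrDr !raddfD /= Hx Hy.
  - by rewrite -!rmorphM; apply: MarkovC (tr_Markov htr) _ _ _.
  - by rewrite !mulrA -rmorphM -[in RHS]mulrA -rmorphM !tau !rmorphM /= mulrA.
have eC x : tr _ (ebar m.+2 * x) = tr _ (x * ebar _).
  move: x; apply: Br_span_theta => [x y Hx Hy|k|a y b].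
  - by rewrite mulrDl mulrDr !raddfD /= Hx Hy.
  - have := tau 1 1 k; rewrite rmorph1 mul1r theta1 => ->.
    by have := tau 1 k 1; rewrite rmorph1 mulr1 theta1 => ->; rewrite !mulr1 !mul1r.
  have -> : ebar _ * (HtoBr N _ a * theta y * HtoBr N _ b) =
      HtoBr N _ 1 * theta (theta_inv (HtoBr N _ a) * y) * HtoBr N _ b.
    rewrite rmorph1 mul1r thetaM theta_invK.
    by rewrite -[_ * ebar _ * theta y]mulrA ebar_theta !mulrA.
  have -> : HtoBr N _ a * theta y * HtoBr N _ b * ebar _ =
      HtoBr N _ a * theta (y * theta_inv (HtoBr N _ b)) * HtoBr N _ 1.
    rewrite rmorph1 mulr1 thetaM theta_invK.
    by rewrite !mulrA -(mulrA _ (theta y) (ebar _)) theta_ebar.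
  by rewrite !tau rmorph1 mulr1 mul1r; congr (_ * _); rewrite -[in LHS]mulrA trC.
move=> x y; elim/Br_ind: y x => [x|y z Hy Hz x|a y Hy x|i y im Hy x|_ y Hy x].
- by rewrite mul1r mulr1.
- by rewrite mulrDl mulrDr !raddfD /= Hy Hz.
- by rewrite -scalerAl -scalerAr !linearZ /= Hy.
- by rewrite mulrA Hy mulrA -HtoBr_g // -HC mulrA.
- rewrite e_ebar // -scalerAl -scalerAr -scalerAl !linearZ /=; congr (_ * _).
  by rewrite mulrA Hy mulrA -eC mulrA.
Qed.

Lemma tr_comm n (x y : Br n) : tr n (x * y) = tr n (y * x).
Proof. by case: (trace_onP n) => + _; apply. Qed.

Lemma tr_theta m (y : Br m) : tr _ (theta y) = kappa * tr m y.
Proof.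
have [_ /(_ 1 y 1)] := trace_onP m.+2.
by rewrite rmorph1 !mul1r !mulr1 theta_inv1 mulr1.
Qed.

Lemma incl_ebark2 n : (3 < n)%N -> BrtoBr N n (ebark n 2) = ebark n.+1 2.
Proof.
move=> n3; rewrite !ebark2 //; last exact: ltnW.
by rewrite !rmorphM /= !incl_eb ?incl_gV ?BrtoBr_g //; lia.
Qed.

(** The maps [theta] at m and m + 1 come from separate Psi's; both composites are linear and
    multiplicative, and they agree on generators. *)
Lemma incl_theta m (y : Br m) : BrtoBr N m.+2 (theta y) = theta (BrtoBr N m y).
Proof.
elim/Br_ind: y => [|x y Hx Hy|a x Hx|i x im Hx|m1 x Hx].
- by rewrite rmorph1 !theta1 incl_eb.
- by rewrite !raddfD /= Hx Hy.
- by rewrite !linearZ /= Hx.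
- rewrite rmorphM !thetaM rmorphM /= Hx BrtoBr_g // !theta_g ?rmorphM /= ?incl_eb
  ?BrtoBr_g //; lia.
- rewrite e_ebar // -scalerAl !linearZ /= rmorphM !thetaM rmorphM /= Hx incl_eb //
  !theta_eb ?incl_ebark2 //; lia.
Qed.

Lemma incl_theta_inv m (x : Br m.+2) :
  theta_inv (BrtoBr N m.+2 x) = BrtoBr N m (theta_inv x).
Proof.
apply: (@theta_inj N hN Psi hPsi m.+1); rewrite theta_invK -incl_theta theta_invK.
by rewrite !rmorphM /= incl_eb.
Qed.

(** The Markov trace is compatible with inclusion on H, and the sandwich formula descends by two on
    the rest. *)
Lemma tr_incl n (x : Br n) : tr n.+1 (BrtoBr N n x) = tr n x.
Proof.
have onH m (h : H m) : tr m.+1 (BrtoBr N m (HtoBr N m h)) = tr m (HtoBr N m h).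
  by rewrite incl_HtoBr; apply: Markov_incl (tr_Markov htr) _ _.
elim/ltn_ind: n x => n IH; case: (ltnP n 2) => [n2 x|].
  by have [h ->] := Br_small n2 x.
case: n IH => [|[|m]] // IH _; apply: Br_span_theta => // [x y Hx Hy|a y b].
  by rewrite !raddfD /= Hx Hy.
have [_ tau] := trace_onP m.+2; have [_ tauS] := trace_onP m.+3.
rewrite !rmorphM /= incl_theta !incl_HtoBr tauS tau -!incl_HtoBr -rmorphM /=.
by rewrite incl_theta_inv -rmorphM IH.
Qed.

End Trace.

(** * Markov property *)

Section Markov.
Variables (N : int).
Hypothesis hN : N != 0.
Variable Psi : forall k m : nat, Br N (m + k.*2) -> Br N m.
Hypothesis hPsi : forall k m : nat, is_Psi (@Psi k m).
Variable tr : forall n : nat, {scalar Br N n}.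
Hypothesis htr : is_tr Psi tr.
Local Notation g := (@Defs.g N).
Local Notation ginv := (@gV N).
Local Notation ebar := (@eb N).
Local Notation ebark := (@ebk N).
Local Notation Br := (@Defs.Br N).
Local Notation H := (@Defs.H N).
Local Notation Hg := (@Defs.Hg N).
Local Notation q := (@Defs.q N).
Local Notation theta := (@theta N hN Psi hPsi).
Local Notation theta_inv := (@theta_inv N Psi).
Local Notation kappa := (@kappa N).
Local Notation zeta := (@zeta N).
Local Notation v := (@ascend N).
Local Notation vI := (@descendV N).
Local Notation f := (@eb_last N).
Local Notation incl n := (BrtoBr N n).

Lemma incl_ascend n d : (d.+1 < n)%N -> incl n (v n d) = v n.+1 d.
Proof.
by elim: d => [|d IHd] dn; rewrite ?ascend0 ?rmorph1 // !ascendS rmorphM /= BrtoBr_g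
  ?IHd //; lia.
Qed.

Lemma incl_descendV n d : (d.+1 < n)%N -> incl n (vI n d) = vI n.+1 d.
Proof.
by elim: d => [|d IHd] dn; rewrite ?descendV0 ?rmorph1 // !descendVS rmorphM /= incl_gV
  ?IHd //; lia.
Qed.

Lemma incl_eb_last n d : (d.+1 < n)%N -> incl n (f n d) = f n.+1 d.
Proof. by move=> dn; rewrite !eb_lastE !rmorphM /= incl_ascend // incl_descendV //
  incl_eb //; lia. Qed.

Lemma comm_ascend n d i : (d.+2 < i < n)%N -> GRing.comm (g n i) (v n d).
Proof.
move=> id; apply: (gen_comm (P := [pred j | (j < d.+2)%N])).
  by move=> j jn; rewrite inE => jd; apply: gg_comm; lia.
by apply: gen_ascend => [|j]; rewrite ?inE; lia.
Qed.

Lemma comm_descendV n d i : (d.+2 < i < n)%N -> GRing.comm (g n i) (vI n d).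
Proof.
move=> id; apply: (gen_comm (P := [pred j | (j < d.+2)%N])).
  by move=> j jn; rewrite inE => jd; apply: gg_comm; lia.
by apply: gen_descendV => [|j]; rewrite ?inE; lia.
Qed.

(** The outer g_(d+3) and its inverse commute with the shorter words. As g_(d+3) also commutes with
    ebar, compressions can be computed recursively. *)
Lemma ascend_conj n d : (d.+3 < n)%N ->
  v n d.+2 * vI n d.+1 = ginv n d.+3 * (v n d.+1 * vI n d) * g n d.+3.
Proof.
move=> dn; have cv := @comm_ascend n d d.+3; have cvI := @comm_descendV n d d.+3.
have -> : v n d.+2 * vI n d.+1 =
    v n d * (g n d.+2 * g n d.+3 * ginv n d.+2) * vI n d by rewrite !ascendS descendVS
      !mulrA.
have cV : v n d * ginv n d.+3 = ginv n d.+3 * v n d.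
  by apply/commr_ginv/commr_sym/cv; lia.
by rewrite conj_gS // ascendS !mulrA cV -!mulrA cvI //; lia.
Qed.

Lemma ebar_ascend n d : (d.+2 < n)%N ->
  ebar n * (v n d.+1 * vI n d) * ebar n = zeta *: ebar n.
Proof.
elim: d => [|d IHd] dn; first by rewrite ascendS ascend0 descendV0 mul1r mulr1 ebar_g2.
by rewrite ascend_conj //; apply: ebar_conj_scalar => //; apply: IHd; lia.
Qed.

(** The same recursion around g_1; it starts one letter later so that g_2, which does not commute
    with g_1, stays inside. *)
Lemma ascend_g1_conj n d : (d.+4 < n)%N ->
  v n d.+3 * g n 1 * vI n d.+2 = ginv n d.+4 * (v n d.+2 * g n 1 * vI n d.+1) * g n d.+4.
Proof.
move=> dn; have cv := @comm_ascend n d.+1 d.+4; have cvI := @comm_descendV n d.+1 d.+4.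
have c13 : GRing.comm (g n 1) (ginv n d.+3) by apply/commr_ginv/gg_comm; lia.
have c14 : GRing.comm (g n d.+4) (g n 1) by apply: gg_comm; lia.
have -> : v n d.+3 * g n 1 * vI n d.+2 =
    v n d.+1 * (g n d.+3 * g n d.+4 * ginv n d.+3) * g n 1 * vI n d.+1.
  by rewrite !ascendS descendVS -!mulrA (mulrA (g n 1) (ginv n d.+3)) c13 !mulrA.
rewrite conj_gS; try lia.
have cV : v n d.+1 * ginv n d.+4 = ginv n d.+4 * v n d.+1.
  by apply/commr_ginv/commr_sym/cv; lia.
rewrite (@ascendS N n d.+1) !mulrA cV -!mulrA -cvI; last lia.
by rewrite (mulrA (g n d.+4)) c14 !mulrA.
Qed.

(** The base case is [crossing_mixed], where theta(ebar) = ebar_(2). Each further conjugation by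
    g_(d+4) corresponds under [theta] to one by g_(d+2), which carries [f m d] to [f m d.+1]. *)
Lemma ebar_ascend_g1 m d : (d.+1 < m)%N ->
  ebar m.+2 * (v m.+2 d.+2 * g m.+2 1 * vI m.+2 d.+1) * ebar m.+2 =
  q *: theta (f m d) + ((q - 1) * zeta) *: ebar m.+2.
Proof.
elim: d => [|d IHd] dm.
  by rewrite eb_lastE !ascendS descendVS !ascend0 !descendV0 !mul1r !mulr1 theta_eb //
    crossing_mixed.
rewrite ascend_g1_conj // ebar_conj // IHd; last lia.
rewrite eb_lastS !thetaM theta_gV ?theta_g; try lia.
have cg : GRing.comm (ebar m.+2) (g m.+2 d.+4) by apply: ebar_comm => //; lia.
have cgV : GRing.comm (ebar m.+2) (ginv m.+2 d.+4) by apply: ebar_commV => //; lia.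
rewrite mulrDr mulrDl -!scalerAr -!scalerAl; congr (_ *: _ + _ *: _).
  by rewrite cgV -!mulrA (mulrA (ebar _)) ebar_theta (mulrA _ (ebar _)) theta_ebar.
by rewrite -mulrA cg mul_gVK //; lia.
Qed.

Lemma ascend_g1 n d : (d.+2 < n)%N -> v n d.+1 * g n 1 * vI n d.+1 = g n 2 * g n 1 *
  ginv n 2.
Proof.
elim: d => [|d IHd] dn; first by rewrite ascendS descendVS ascend0 descendV0 mul1r mulr1.
rewrite -IHd; last lia.
rewrite ascendS descendVS -!mulrA; congr (_ * _); rewrite (mulrA (g n d.+3)).
have -> : g n d.+3 * g n 1 = g n 1 * g n d.+3 by apply: gg_comm; lia.
by rewrite -mulrA mul_gK //; lia.
Qed.

Lemma ebar_absorb m (k : Br m.+2) (y : Br m) : GRing.comm (ebar m.+2) k ->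
  k * theta y = theta (theta_inv k * y) /\ theta y * k = theta (y * theta_inv k).
Proof.
move=> ck; rewrite !thetaM theta_invK; split.
  by rewrite ck -!mulrA !ebar_theta.
by rewrite -mulrA -ck !mulrA !theta_ebar.
Qed.

(** [theta] raises indices by 2 and [vI] lowers them by 1, so [w] leaves on the left as an element
    of H_(m+1). *)
Lemma descendV_shift_theta m (w : H m) : exists2 k : Br m.+2, gen [pred i | (i <
  m.+1)%N] k &
  forall y, vI m.+2 m * theta (HtoBr N m w * y) = k * vI m.+2 m * theta y.
Proof.
elim/H_ind: w => [|x y [k Pk kE] [k' Pk' kE']|a x [k Pk kE]|i x im [k Pk kE]].
- by exists 1 => [|y]; [apply: Gen1 | rewrite rmorph1 !mul1r].
- exists (k + k') => [|z]; first exact: GenD.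
  by rewrite raddfD mulrDl raddfD mulrDr /= kE kE' !mulrDl.
- exists (a *: k) => [|z]; first exact: GenZ.
  by rewrite linearZ /= -scalerAl linearZ /= -scalerAr kE -!scalerAl.
exists (g m.+2 i.+1 * k) => [|z]; first by apply: GenM => //=; lia.
rewrite rmorphM /= HtoBr_g // -mulrA thetaM theta_g //.
have -> : ebar m.+2 * g m.+2 i.+2 = g m.+2 i.+2 * ebar m.+2.
  by apply: ebar_comm; lia.
rewrite -mulrA ebar_theta mulrA descendV_shift; try lia.
by rewrite -mulrA kE !mulrA.
Qed.

(** Conjugation by [v] turns g_(i+1) into g_(i+2), which is theta(g_i) inside the corner and
    commutes with ebar. *)
Lemma ascend_conj_theta m (u : Br m.+2) : gen [pred i | (1 < i < m.+1)%N] u ->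
  exists w : H m, theta (HtoBr N m w) = ebar m.+2 * (v m.+2 m * u * vI m.+2 m) /\
    theta (HtoBr N m w) = v m.+2 m * u * vI m.+2 m * ebar m.+2.
Proof.
elim=> {u} [|x y _ [w [E1 E2]] _ [w' [E1' E2']]|a x _ [w [E1 E2]]|i x im iN _ [w [E1
  E2]]].
- by exists 1; rewrite rmorph1 theta1 mulr1 ascend_descendV // mulr1 mul1r.
- exists (w + w'); rewrite !raddfD /= !(mulrDr, mulrDl); split; first by rewrite E1 E1'.
  by rewrite E2 E2'.
- by exists (a *: w); rewrite !linearZ /= -!scalerAr -!scalerAl -!scalerAr; split;
  congr (_ *: _).
case: i im iN => [|i] //= im iN; exists (Hg m i * w).
have im' : (0 < i < m)%N by lia.
rewrite rmorphM /= HtoBr_g // thetaM theta_g //.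
have c : ebar m.+2 * g m.+2 i.+2 = g m.+2 i.+2 * ebar m.+2.
  by apply: ebar_comm; lia.
have -> : v m.+2 m * (g m.+2 i.+1 * x) * vI m.+2 m = g m.+2 i.+2 * (v m.+2 m * x * vI
  m.+2 m).
  by rewrite mulrA ascend_shift ?mulrA //; lia.
rewrite c -[in X in X /\ _]mulrA -[in X in _ /\ X]mulrA ebar_theta; split.
  by rewrite mulrA c -mulrA -E1.
by rewrite -mulrA -E2.
Qed.

(** By [ebark2_absl], g_3^-1 becomes g_1^-1. The letters from index 4 on then commute with
    everything up to ebar and pass to its right. *)
Lemma descendV_ebark2 n d : (1 < d)%N -> (d.+1 < n)%N -> exists x,
  vI n d * ebark n 2 = ginv n 1 * ginv n 2 * ebar n * x.
Proof.
case: d => [|[|d]] // _; elim: d => [|d IHd] dn.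
  have ee : ebar n * ebark n 2 = ebark n 2 by rewrite ebark2 // !mulrA ebar_idem //; lia.
  by exists (ebark n 2); rewrite !descendVS descendV0 mulr1 -mulrA ebark2_absl //
    -!mulrA ee.
have [x xE] := IHd (ltnW dn); exists (ginv n d.+4 * x).
have C i : (0 < i < 3)%N -> GRing.comm (ginv n d.+4) (ginv n i).
  by move=> i3; apply/commr_ginv/commr_sym/commr_ginv/gg_comm; lia.
have Ce : GRing.comm (ginv n d.+4) (ebar n) by apply/commr_sym/ebar_commV; lia.
have C3 : GRing.comm (ginv n d.+4) (ginv n 1 * ginv n 2 * ebar n).
  by apply: commrM Ce; apply: commrM; apply: C.
by rewrite descendVS -mulrA xE [LHS]mulrA C3 -mulrA.
Qed.

Let trC n (x y : Br n) : tr n (x * y) = tr n (y * x).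
Proof. exact: (tr_comm hN hPsi htr). Qed.

Let trT m (y : Br m) : tr _ (theta y) = kappa * tr m y.
Proof. exact: (tr_theta hN hPsi htr). Qed.

Definition markov_at n (c : Br n) := tr n.+1 (incl n c * g n.+1 n) = zeta * tr n c.

Lemma markovD n (x y : Br n) : markov_at x -> markov_at y -> markov_at (x + y).
Proof. by rewrite /markov_at => xM yM; rewrite !raddfD mulrDl raddfD /= xM yM mulrDr. Qed.

Lemma markovZ n a (x : Br n) : markov_at x -> markov_at (a *: x).
Proof. by rewrite /markov_at => xM; rewrite !linearZ -scalerAl linearZ /= xM mulrCA. Qed.

Lemma markov_H n (h : H n) : (0 < n)%N -> markov_at (HtoBr N n h).
Proof.
move=> n0; rewrite /markov_at trC incl_HtoBr -HtoBr_g; last lia.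
by rewrite -rmorphM zeta.unlock /=; apply: Markov_g (tr_Markov htr) _ _ n0.
Qed.

(** The letters of [u] commute with g_n, so [u] can be rotated around the trace. *)
Lemma markov_conj n (u x : Br n) : (0 < n)%N -> gen [pred i | (i < n.-1)%N] u ->
  markov_at (x * u) <-> markov_at (u * x).
Proof.
move=> n0 Pu; rewrite /markov_at [tr n (u * x)]trC.
have c : GRing.comm (g n.+1 n) (incl n u).
  by apply: gen_comm (incl_gen Pu) => i ilt /= id; apply: gg_comm; lia.
suff -> : tr n.+1 (incl n (u * x) * g n.+1 n) = tr n.+1 (incl n (x * u) * g n.+1 n) by [].
by rewrite !rmorphM /= -[in LHS]mulrA trC -[in LHS]mulrA c mulrA.
Qed.

(** * Markov property for multiples of ebar *)

Section Step.
Variable m : nat.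
Hypothesis IH : forall j, (0 < j)%N -> (j < m.+2)%N -> forall c : Br j, markov_at c.

(** In the corner g_(m+2) acts as theta(g_m), so both sides are [kappa] times the claim for m. *)
Lemma markov_corner (x : Br m.+2) : (0 < m)%N -> markov_at (ebar m.+2 * x * ebar m.+2).
Proof.
move=> m0; rewrite -(@theta_invK N hN Psi hPsi) /markov_at incl_theta -theta_ebar -mulrA.
rewrite -(@theta_g N hN Psi hPsi m.+1 m); last lia. rewrite -thetaM.
rewrite !trT.
have := @IH m m0 (ltnW (ltnSn _)) (theta_inv x); rewrite /markov_at => ->.
by rewrite mulrCA.
Qed.

Lemma markov_ebar (x : Br m.+2) : (0 < m)%N -> markov_at (ebar m.+2 * x).
Proof.
move=> m0; have := markov_corner x m0; rewrite /markov_at.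
have idE : ebar m.+2 * ebar m.+2 = ebar m.+2 by apply: ebar_idem.
have idE3 : ebar m.+3 * ebar m.+3 = ebar m.+3 by apply: ebar_idem.
have c : ebar m.+3 * g m.+3 m.+2 = g m.+3 m.+2 * ebar m.+3 by apply: ebar_comm; lia.
rewrite [in X in _ = X]trC mulrA idE => <-.
rewrite !rmorphM /= incl_eb // -!mulrA c -[in LHS]idE3 -mulrA trC !mulrA.
by rewrite -!mulrA.
Qed.

Lemma markov_ebar_r (x : Br m.+2) : (0 < m)%N -> markov_at (x * ebar m.+2).
Proof.
move=> m0; have := markov_corner x m0; rewrite /markov_at.
have idE : ebar m.+2 * ebar m.+2 = ebar m.+2 by apply: ebar_idem.
have idE3 : ebar m.+3 * ebar m.+3 = ebar m.+3 by apply: ebar_idem.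
have c : ebar m.+3 * g m.+3 m.+2 = g m.+3 m.+2 * ebar m.+3 by apply: ebar_comm; lia.
rewrite -(mulrA (ebar m.+2)) [in X in _ = X]trC -mulrA idE => <-.
rewrite !rmorphM /= incl_eb // -!mulrA c.
by rewrite [in RHS]trC -!mulrA idE3.
Qed.

Lemma markov_l (a x : Br m.+2) : (0 < m)%N -> gen [pred i | (i < m.+1)%N] a ->
  markov_at (a * (ebar m.+2 * x)).
Proof.
by move=> m0 Pa; apply/(@markov_conj m.+2 a _ isT Pa); rewrite -mulrA; apply: markov_ebar.
Qed.

Lemma markov_r (a x : Br m.+2) : (0 < m)%N -> gen [pred i | (i < m.+1)%N] a ->
  markov_at (x * ebar m.+2 * a).
Proof.
by move=> m0 Pa; apply/(@markov_conj m.+2 a _ isT Pa); rewrite mulrA; apply: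
  markov_ebar_r.
Qed.

End Step.

(** * Traces of products with f *)

Lemma tr_ebar_sandwich m (X Z : Br m.+2) : GRing.comm (ebar m.+2) Z ->
  tr _ (ebar m.+2 * X * Z) = tr _ (ebar m.+2 * X * ebar m.+2 * (ebar m.+2 * Z)).
Proof.
have idE : ebar m.+2 * ebar m.+2 = ebar m.+2 by apply: ebar_idem.
move=> cZ; have -> : ebar m.+2 * X * ebar m.+2 * (ebar m.+2 * Z) = ebar m.+2 * X * Z *
  ebar m.+2.
  by rewrite -mulrA (mulrA (ebar _) (ebar _)) idE cZ !mulrA.
by rewrite [in RHS]trC !mulrA idE.
Qed.

(** Rotating [vI] to the end conjugates [G] and [u] by [v]; the conjugate of [u] commutes with ebar
    and becomes theta(w) in the corner. *)
Lemma tr_eb_last_mul m (G u : Br m.+2) (w : H m) :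
  theta (HtoBr N m w) = ebar m.+2 * (v m.+2 m * u * vI m.+2 m) ->
  theta (HtoBr N m w) = v m.+2 m * u * vI m.+2 m * ebar m.+2 ->
  tr _ (f m.+2 m * (G * u)) =
  tr _ (ebar m.+2 * (v m.+2 m * G * vI m.+2 m) * ebar m.+2 * theta (HtoBr N m w)).
Proof.
move=> E1 E2; rewrite E1 -tr_ebar_sandwich; last by rewrite /GRing.comm -E1.
rewrite eb_lastE -!mulrA trC; congr (tr _ _).
by rewrite -!mulrA (mulrA (vI _ _) (v _ _)) descendV_ascend // mul1r.
Qed.

(** As before, except that g_(m+2) first moves left past G u and lengthens [v] by one letter. *)
Lemma tr_eb_last_mul_g m (G u : Br m.+2) (w : H m) :
  theta (HtoBr N m w) = ebar m.+2 * (v m.+2 m * u * vI m.+2 m) ->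
  theta (HtoBr N m w) = v m.+2 m * u * vI m.+2 m * ebar m.+2 ->
  GRing.comm (incl m.+2 (G * u)) (g m.+3 m.+2) ->
  tr _ (incl m.+2 (f m.+2 m * (G * u)) * g m.+3 m.+2) =
  tr _ (ebar m.+3 * (v m.+3 m.+1 * incl m.+2 G * vI m.+3 m) * ebar m.+3 *
    theta (incl m (HtoBr N m w))).
Proof.
move=> E1 E2 ct; set Z := incl m.+2 (v m.+2 m * u * vI m.+2 m).
have E1' : theta (incl m (HtoBr N m w)) = ebar m.+3 * Z.
  by rewrite -incl_theta E1 rmorphM /= incl_eb.
have E2' : theta (incl m (HtoBr N m w)) = Z * ebar m.+3.
  by rewrite -incl_theta E2 rmorphM /= incl_eb.
rewrite E1' -tr_ebar_sandwich; last by rewrite /GRing.comm -E1'.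
rewrite rmorphM -mulrA ct /= incl_eb_last // eb_lastE -!mulrA [in LHS]trC; congr (tr _ _).
rewrite ascendS /Z !rmorphM /= incl_ascend // incl_descendV //.
by rewrite -!mulrA (mulrA (vI _ _) (v _ _)) descendV_ascend // mul1r. 
Qed.

Lemma tr_scalar (a : ground N) n : tr n a%:A = a.
Proof.
have := Markov1 (tr_Markov htr) n; rewrite rmorph1 => t1.
by rewrite linearZ /= t1 mulr1.
Qed.

(** Induction on d through the conjugation by g_(d+2) that takes f to the next f. It cancels against
    words in the letters up to d; for words x g_(d+1) y, the Markov property at d + 1 and d + 2
    yields z on both sides. *)
Lemma tr_eb_last d (w : Br d.+1) :
  (forall j, (0 < j)%N -> (j < d.+2)%N -> forall c : Br j, markov_at c) ->
  gen predT w -> tr _ (f d.+2 d * incl _ w) = kappa * tr _ w.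
Proof.
elim: d w => [|d IHd] w IH Pw.
  have [a ->] : exists a, w = a%:A.
    elim: Pw => {w} [|x y _ [a ->] _ [b ->]|a x _ [b ->]|i x _ i1 _ _]; last lia.
    - by exists 1; rewrite scale1r.
    - by exists (a + b); rewrite scalerDl.
    - by exists (a * b); rewrite scalerA.
  rewrite tr_scalar linearZ /= rmorph1 -scalerAr mulr1 linearZ /=.
  rewrite eb_lastE ascend0 descendV0 mul1r mulr1 -(@theta1 N hN Psi hPsi) trT
    -[1]scale1r tr_scalar.
  by rewrite mulr1 mulrC.
have IH' j : (0 < j)%N -> (j < d.+2)%N -> forall c : Br j, markov_at c.
  by move=> j0 jd; apply: IH => //; lia.
have Pw' : gen [pred i | (i < d.+2)%N] w by apply: gen_sub Pw => i id _ /=; lia.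
have jd : (0 < d.+1 < d.+2)%N by lia.
have restr (u : Br d.+2) : gen [pred i | (i < d.+1)%N] u ->
    exists2 x : Br d.+1, gen predT x & u = incl _ x.
  by move=> /gen_restr[] // x Px ->; exists x => //; apply: gen_sub Px.
have cs (x : Br d.+1) : gen predT x -> GRing.comm (g d.+3 d.+2) (incl _ (incl _ x)).
  move=> Px; have Px' : gen [pred i | (i < d.+1)%N] x by apply: gen_sub Px => i /=; lia.
  by apply: gen_comm (incl_gen (incl_gen Px')) => i ilt /= id; apply: gg_comm; lia.
have s2 : (0 < d.+2 < d.+3)%N by lia.
have trI n (y : Br n) : tr n.+1 (incl n y) = tr n y by apply: (tr_incl hN hPsi htr).
have f2E : incl _ (f d.+2 d) = f d.+3 d by rewrite incl_eb_last.
apply: (@span_ind N _ _ (fun y => tr _ (f d.+3 d.+1 * incl _ y) = kappa * tr _ y) _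
  (two_sided_last jd Pw')) => [x y|t [Pt|[u [u2 [Pu Pu2 ->]]]]].
- by rewrite !raddfD /= mulrDr !raddfD /= => -> ->; rewrite mulrDr.
- have [x Px ->] := restr t Pt; rewrite eb_lastS -!mulrA trC -!mulrA.
  rewrite (mulrA (g _ _)) cs // -!mulrA gmulrV // mulr1 -f2E -rmorphM !trI.
  exact: IHd IH' Px.
have [x Px ->] := restr u Pu; have [y Py ->] := restr u2 Pu2.
rewrite [in RHS]trC !mulrA.
have r1 : (0 < d.+1 < d.+2)%N by [].
have Mr := @IH d.+1 isT (ltnW (ltnSn _)) (y * x); rewrite /markov_at rmorphM in Mr.
rewrite Mr.
set s := g d.+3 d.+2; set r := g d.+3 d.+1.
set X := incl _ (incl _ x); set Y := incl _ (incl _ y).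
have -> : tr d.+3 (f d.+3 d.+1 * incl _ (incl _ x * g d.+2 d.+1 * incl _ y)) =
    tr d.+3 (incl d.+2 (g d.+2 d.+1 * incl _ y * f d.+2 d * incl _ x * ginv d.+2 d.+1)
      * s).
  rewrite !rmorphM /= f2E BrtoBr_g // incl_gV // -/s -/r -/X -/Y.
  rewrite [in LHS]eb_lastS -!mulrA trC -/s -!mulrA.
  have -> : s * (X * (r * (Y * ginv d.+3 d.+2))) = X * (s * r * ginv d.+3 d.+2) * Y.
    have cX : s * X = X * s by apply: cs.
    have cY : GRing.comm Y (ginv d.+3 d.+2) by apply/commr_ginv/commr_sym/cs.
    by rewrite cY !mulrA cX.
  (* Here s r s^-1 = r^-1 s r leaves a single [s] beside an element of A_(d+2), ready for the Markov
     property there. *)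
  rewrite conj_g // -/r -/s -!mulrA.
  by rewrite [in RHS]mulrA [in RHS]trC -!mulrA.
have := @IH d.+2 isT (ltnSn _) (g d.+2 d.+1 * incl _ y * f d.+2 d * incl _ x * ginv
  d.+2 d.+1).
rewrite /markov_at => ->; rewrite [in LHS]trC !mulrA gmulVr // mul1r.
rewrite -mulrA trC -mulrA -rmorphM (IHd _ IH'); last exact: gen_mul.
by rewrite mulrCA mulrA [in LHS]trC.
Qed.

(** * The remaining double coset and the induction step *)

Section Step2.
Variable d : nat.
Local Notation m := d.+1.
Hypothesis IH : forall j, (0 < j)%N -> (j < m.+2)%N -> forall c : Br j, markov_at c.

Lemma markov_eb_last_U (u : Br m.+2) : gen [pred i | (1 < i < m.+1)%N] u ->
  markov_at (f m.+2 m * u).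
Proof.
move=> Pu; have [w [E1 E2]] := ascend_conj_theta Pu.
have ct : GRing.comm (incl m.+2 (1 * u)) (g m.+3 m.+2).
  rewrite mul1r; apply: commr_sym.
  by apply: gen_comm (incl_gen Pu) => i ilt /= id; apply: gg_comm; lia.
rewrite -[u]mul1r /markov_at (tr_eb_last_mul_g E1 E2 ct) (tr_eb_last_mul 1 E1 E2).
rewrite rmorph1 !mulr1 ebar_ascend // ascend_descendV // mulr1 ebar_idem //.
rewrite -scalerAl !ebar_theta linearZ /= !trT; congr (_ * (_ * _)).
exact: (tr_incl hN hPsi htr).
Qed.

(** The left side is kappa (q kappa + (q - 1) z) tr w, the right side kappa z^2 tr w; [zeta_sq]
    equates them. *)
Lemma markov_eb_last_g1_U (u : Br m.+2) : gen [pred i | (1 < i < m.+1)%N] u ->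
  markov_at (f m.+2 m * (g m.+2 1 * u)).
Proof.
move=> Pu; have [w [E1 E2]] := ascend_conj_theta Pu.
have ct : GRing.comm (incl m.+2 (g m.+2 1 * u)) (g m.+3 m.+2).
  rewrite rmorphM /= BrtoBr_g //; apply: commr_sym; apply: commrM.
    by apply: gg_comm; lia.
  by apply: gen_comm (incl_gen Pu) => i ilt /= id; apply: gg_comm; lia.
rewrite /markov_at (tr_eb_last_mul_g E1 E2 ct) (tr_eb_last_mul (g m.+2 1) E1 E2).
rewrite BrtoBr_g // ebar_ascend_g1 // ascend_g1 // ebar_g2_conj //.
rewrite mulrDl -!scalerAl !ebar_theta -thetaM raddfD /= !linearZ /= !trT.
have IH' j : (0 < j)%N -> (j < d.+2)%N -> forall c : Br j, markov_at c.
  by move=> j0 jd; apply: IH => //; lia.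
rewrite (tr_eb_last IH'); last exact: gen_HtoBr.
rewrite (tr_incl hN hPsi htr); move: (tr _ _) => t.
transitivity (kappa * zeta ^+ 2 * t); last by ring.
by rewrite -(zeta_sq hN); ring.
Qed.

(** Splitting off g_1 leaves u or x g_1 y; the left factor x commutes with f and is rotated to the
    right. *)
Lemma markov_eb_last (u : Br m.+2) : gen [pred i | (i < m.+1)%N] u -> markov_at (f m.+2
  m * u).
Proof.
move=> Pu; have Pu' : gen [pred i | (1 <= i < m.+1)%N] u.
  by apply: gen_sub Pu => i /andP[i0 _] /=; rewrite i0.
have n1 : (0 < 1 < m.+2)%N by [].
apply: (@span_ind N _ _ (fun u => markov_at (f m.+2 m * u)) _ (two_sided_first n1 Pu')).
- by move=> x y Mx My; rewrite mulrDr; apply: markovD.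
move=> t [Pt|[x [y [Px Py ->]]]]; first exact: markov_eb_last_U.
have c : GRing.comm (f m.+2 m) x by apply: eb_last_comm => //; lia.
have Px' : gen [pred i | (i < m.+1)%N] x by apply: gen_sub Px => i _ /=; lia.
rewrite !mulrA c -!mulrA; apply/(@markov_conj m.+2 x _ isT Px').
by rewrite -!mulrA; apply: markov_eb_last_g1_U; apply: gen_mul.
Qed.

Lemma Br_H_or_ebar n (Q : Br n -> Prop) :
  (forall x y, Q x -> Q y -> Q (x + y)) -> (forall h, Q (HtoBr N _ h)) ->
  (forall h z, (1 < n)%N -> Q (HtoBr N _ h * (ebar n * z))) -> forall x, Q x.
Proof.
move=> QD QH Qe; case: (ltnP n 2) => [n2 x|].
  by have [h ->] := Br_small n2 x.
case: n Q QD QH Qe => [|[|n]] // Q QD QH Qe _.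
apply: (@Br_span_theta N hN Psi hPsi) => // a y b.
by rewrite -[theta y]ebar_theta -!mulrA; apply: Qe.
Qed.

Lemma markov_middle (h h' : Br m.+2) y : gen [pred i | (i < m.+1)%N] h ->
  gen [pred i | (i < m.+1)%N] h' ->
  markov_at (h * vI m.+2 m * theta y * v m.+2 m * h').
Proof.
move=> Ph Ph'; move: y; apply: Br_H_or_ebar => [x y Mx My|w|w z m1].
- by rewrite raddfD mulrDr !mulrDl; apply: markovD.
(* For y in H, moving y to the left of [vI] leaves [vI] ebar [v], which is f; the outer factors are
   then rotated together. *)
- have [k Pk kE] := descendV_shift_theta w; have := kE 1; rewrite mulr1 theta1 => {}kE.
  rewrite -(mulrA h) kE; apply/(@markov_conj m.+2 h' _ isT Ph').
  have -> : h' * (h * (k * vI m.+2 m * ebar m.+2) * v m.+2 m) = h' * h * k * f m.+2 m.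
    by rewrite eb_lastE !mulrA.
  have P : gen [pred i | (i < m.+1)%N] (h' * h * k) by apply: gen_mul => //; apply:
    gen_mul.
  by apply/(@markov_conj m.+2 _ _ isT P); apply: markov_eb_last.
(* For y in H ebar A_m, theta(ebar) = ebar_(2) lets ebar stand directly behind an element of
   H_(m+1), the situation of [markov_l]. *)
have [k Pk kE] := descendV_shift_theta w.
have [x xE] := @descendV_ebark2 m.+2 m m1 (ltnSn _).
rewrite -(mulrA h) kE thetaM theta_eb // -(mulrA k) (mulrA (vI _ _)) xE.
have -> : h * (k * (ginv m.+2 1 * ginv m.+2 2 * ebar m.+2 * x * theta z)) * v m.+2 m * h'
   = h * k * ginv m.+2 1 * ginv m.+2 2 * (ebar m.+2 * (x * theta z * v m.+2 m * h')).
  by rewrite !mulrA.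
apply: markov_l => //; apply: gen_mul; last by apply: gen_gV => //=; lia.
by apply: gen_mul; [apply: gen_mul | apply: gen_gV].
Qed.

Lemma ebar_off2 (k : Br m.+2) : gen (off2 m.+2) k -> GRing.comm (ebar m.+2) k.
Proof.
by apply: gen_comm => i ilt /andP[_ i2]; apply: ebar_comm.
Qed.

Lemma markov_step (c : Br m.+2) : markov_at c.
Proof.
move: c; apply: (@Br_span_theta N hN Psi hPsi) => [x y|h|a y b]; first exact: markovD.
  exact: markov_H.
have PH h : gen [pred i | (i < m.+2)%N] (HtoBr N m.+2 h).
  by apply: gen_sub (gen_HtoBr h) => i /andP[_ ilt].
have n1 : (m.+1 < m.+2)%N by [].
rewrite -mulrA.
apply: (@span_ind N _ _ (fun a => markov_at (a * (theta y * HtoBr N _ b))) _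
  (coset_left n1 (PH a))) => [x z Mx Mz|t [h [k [Ph Pk xE]]]].
  by rewrite mulrDl; apply: markovD.
have [kyE _] := ebar_absorb y (ebar_off2 Pk).
case: xE => ->; rewrite -(mulrA _ k) (mulrA k) kyE.
  (* Without [vI] only an element of H_(m+1) precedes ebar. *)
  by rewrite -ebar_theta -[ebar _ * _ * _]mulrA; apply: markov_l.
move: {kyE} (theta_inv k * y) => {}y.
apply: (@span_ind N _ _ (fun b => markov_at (h * vI _ _ * (theta y * b))) _
  (coset_right n1 (PH b))) => [x z Mx Mz|t' [h' [k' [Ph' Pk' xE]]]].
  by rewrite !mulrDr; apply: markovD.
have [_ ykE] := ebar_absorb y (ebar_off2 Pk').
case: xE => ->; rewrite ?(mulrA (theta y)) ?(mulrA (theta y)) ykE.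
  by rewrite -theta_ebar !mulrA; apply: markov_r.
by rewrite !mulrA; apply: markov_middle.
Qed.

End Step2.

(** The induction step refers to g_(n-2), so n = 1 and n = 2 are treated separately. *)
Lemma markov n (c : Br n) : (0 < n)%N -> markov_at c.
Proof.
elim/ltn_ind: n c => -[|[|[|d]]] // IH c _.
- by have [h ->] := Br_small (ltnSn 1) c; apply: markov_H.
- move: c; apply: (@Br_span_theta N hN Psi hPsi) => [x y|h|a y b]; first exact: markovD.
    exact: markov_H.
  (* In A_2 all of H commutes with ebar, and A_0 consists of scalars, so only c = ebar is left
     besides H. *)
  have C h : GRing.comm (ebar 2) (HtoBr N 2 h).
    by apply: gen_comm (gen_HtoBr h) => i ilt _; apply: ebar_comm => //; lia.
  rewrite (ebar_absorb y (C a)).1 (ebar_absorb _ (C b)).2; move: (_ * _) => z.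
  elim/Br_ind: z => [|x x' Mx Mx'|a' x Mx|i x|] //; last 1 first.
  - by case: i.
  - rewrite theta1 /markov_at incl_eb // -[X in X * _]ebar_idem // -mulrA trC ebar_g2 //.
    by rewrite linearZ /= -incl_eb // (tr_incl hN hPsi htr).
  - by rewrite raddfD; apply: markovD.
  - by rewrite linearZ; apply: markovZ.
by apply: markov_step => j j0 jd c'; apply: IH.
Qed.

End Markov.

Theorem theorem4p5 (N : int) (hN : N != 0)
    (Psi : forall k m : nat, Br N (m + k.*2) -> Br N m)
    (hPsi : forall k m : nat, is_Psi (Psi k m))
    (tr : forall n : nat, {scalar Br N n})
    (htr : is_tr Psi tr)
    (n : nat) (hn : (1 <= n)%N) (c : Br N n) :
  tr n.+1 (BrtoBr N n c * g N n.+1 n) = tr n c * tr n.+1 (g N n.+1 n).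
Proof.
have M := markov hN hPsi htr _ hn.
(* The case c = 1 identifies z with tr g_n. *)
have := M 1; rewrite /markov_at rmorph1 mul1r -[X in tr n X]scale1r.
rewrite (tr_scalar htr) mulr1 => ->.
by rewrite (M c) mulrC.
Qed.
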